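(* Let $H$ be a digital $3$-manifold and let $W(H)$ be the collection of all digital $3$-manifolds equivalent to $H$. If for every $K\in W(H)$ and every digital $2$-disk $D$ belonging to $K$ there is a digital $3$-disk $U$ belonging to $K$ such that $\mathrm{Int}D\subseteq\mathrm{Int}U$, then $H$ is a digital $3$-sphere.
   Context: A digital space is a finite simple undirected graph, its vertices are called points; a subspace is an induced subgraph, and a disk ''belongs to'' $K$ if it is an induced subgraph of $K$. For a point $v$, the rim $O(v)$ is the subspace induced on the neighbours of $v$; $O(v,u)=O(v)\cap O(u)$. The family $T$ of contractible graphs is defined inductively: the one-point graph $K(1)$ belongs to $T$, and $T$ consists of all graphs obtained from $K(1)$ by finite sequences of the following contractible transformations: deleting a point $v$ with $O(v)\in T$; adding a new point $v$ so that its rim is an induced subgraph $H\in T$; deleting an edge $(v,u)$ with $O(v,u)\in T$; adding an edge between non-adjacent points $v,u$ with $O(v,u)\in T$. A digital $0$-disk is a single point; a digital $0$-sphere is the graph consisting of two non-adjacent points. A digital $1$-sphere is a connected graph in which the rim of every point is a $0$-sphere; a digital $1$-disk is a $1$-sphere with one point deleted (its boundary is the pair of endpoints, its interior the remaining points). Recursively for $n\ge2$: a digital $n$-disk is a connected contractible graph $D$ that is a disjoint union $D=\partial D\cup\mathrm{Int}D$ of two nonempty subspaces such that the rim (in $D$) of each point of $\partial D$ is a digital $(n-1)$-disk, the rim of each point of $\mathrm{Int}D$ is a digital $(n-1)$-sphere, and the boundary $\partial D$ is a digital $(n-1)$-sphere; a digital $n$-sphere is a graph $D\#C$ obtained from two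 digital $n$-disks $D,C$ with isomorphic boundaries by identifying each point of $\partial D$ with its counterpart in $\partial C$. A digital $n$-manifold is a connected graph in which the rim of every point is a digital $(n-1)$-sphere. d-Transformations of a digital $n$-manifold $N$: (i) if $D$ is a digital $n$-disk belonging to $N$ and $v\in\mathrm{Int}D$, delete all points of $\mathrm{Int}D$ except $v$ and join $v$ to every point of $\partial D$; (ii) if $v$ is a point of $N$ and $D$ is a digital $n$-disk disjoint from $N$ with $\partial D$ isomorphic to $O(v)$, identify each point of $\partial D$ with its counterpart in $O(v)$ and delete $v$. Two digital $n$-manifolds are equivalent if one can be obtained from the other by a sequence of d-transformations. *)

(* Defs.v *)
From mathcomp Require Import all_boot.

Set Implicit Arguments.
Unset Strict Implicit.
Unset Printing Implicit Defensive.

Record space := Space {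
  point :> finType;
  adj : rel point;
  adj_sym : symmetric adj;
  adj_irr : irreflexive adj
}.

(* The empty graph is not regarded as connected. *)
Definition connected (G : space) : Prop :=
  0 < #|G| /\ forall x y : G, connect (@adj G) x y.

Definition iso (G H : space) : Prop :=
  exists2 f : G -> H, bijective f & forall x y, adj (f x) (f y) = adj x y.

(* f restricts to an isomorphism from the subspace A onto the subspace B;
   the values of f outside A are irrelevant. *)
Definition iso_on (G H : space) (f : G -> H) (A : {set G}) (B : {set H}) :
  Prop :=
  [/\ {in A &, injective f}, f @: A = B
    & {in A &, forall x y, adj (f x) (f y) = adj x y}].

Section Constructions.
Variable G : space.

Section Induced.
Variable A : {set G}.
Definition sub_adj : rel {x : G | x \in A} := fun x y => adj (val x) (val y).
Lemma sub_adj_sym : symmetric sub_adj.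
Proof. by move=> x y; apply: adj_sym. Qed.
Lemma sub_adj_irr : irreflexive sub_adj.
Proof. by move=> x; apply: adj_irr. Qed.
Definition sub : space := Space sub_adj_sym sub_adj_irr.
End Induced.

Definition rim (v : G) : {set G} := [set u | adj v u].
Definition rim2 (v u : G) : {set G} := rim v :&: rim u.

Definition del_point (v : G) : space := sub [set~ v].

Section AddPoint.
Variable A : {set G}.
Definition add_point_adj : rel (option G) := fun x y =>
  match x, y with
  | Some a, Some b => adj a b
  | Some a, None | None, Some a => a \in A
  | None, None => false
  end.
Lemma add_point_sym : symmetric add_point_adj.
Proof. by case=> [x|] [y|] //=; apply: adj_sym. Qed.
Lemma add_point_irr : irreflexive add_point_adj.
Proof. by case=> [x|] //=; apply: adj_irr. Qed.
Definition add_point : space := Space add_point_sym add_point_irr.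
End AddPoint.

Section DelEdge.
Variables v u : G.
Definition del_edge_adj : rel G := fun x y =>
  adj x y && ~~ ((x == v) && (y == u) || (x == u) && (y == v)).
Lemma del_edge_sym : symmetric del_edge_adj.
Proof.
by move=> x y; rewrite /del_edge_adj adj_sym orbC ![_ && (x == _)]andbC.
Qed.
Lemma del_edge_irr : irreflexive del_edge_adj.
Proof. by move=> x; rewrite /del_edge_adj adj_irr. Qed.
Definition del_edge : space := Space del_edge_sym del_edge_irr.
End DelEdge.

(* [join v B] keeps every edge of G and joins v to every point of B. *)
Section Join.
Variables (v : G) (B : {set G}).
Definition join_adj : rel G := fun x y =>
  (x != y) && [|| adj x y, (x == v) && (y \in B) | (y == v) && (x \in B)].
Lemma join_sym : symmetric join_adj.
Proof.
by move=> x y; rewrite /join_adj eq_sym adj_sym [X in _ || X]orbC.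
Qed.
Lemma join_irr : irreflexive join_adj.
Proof. by move=> x; rewrite /join_adj eqxx. Qed.
Definition join : space := Space join_sym join_irr.
End Join.

Definition add_edge (v u : G) : space := join v [set u].

End Constructions.

(* [glue f A B], used when [iso_on f A B], is the disjoint union of G and H in
   which each a in A is identified with f a in B: the identified points are
   represented by their copies in G, so only the points of H outside B are
   added. *)
Section Glue.
Variables (G H : space) (f : G -> H) (A : {set G}) (B : {set H}).
Definition glue_adj : rel (G + {y : H | y \notin B}) := fun p q =>
  match p, q with
  | inl x, inl y => adj x y
  | inr x, inr y => adj (val x) (val y)
  | inl x, inr y | inr y, inl x => (x \in A) && adj (f x) (val y)
  end.
Lemma glue_sym : symmetric glue_adj.
Proof. by move=> [x|x] [y|y] //=; apply: adj_sym. Qed.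
Lemma glue_irr : irreflexive glue_adj.
Proof. by move=> [x|x] /=; apply: adj_irr. Qed.
Definition glue : space := Space glue_sym glue_irr.
End Glue.

(* The family T, with graphs taken up to isomorphism. *)
Inductive contractible : space -> Prop :=
| contractible_K1 (G : space) : #|G| = 1 -> contractible G
| contractible_iso (G H : space) :
    contractible G -> iso G H -> contractible H
| contractible_del_point (G : space) (v : G) :
    contractible G -> contractible (sub (rim v)) ->
    contractible (del_point v)
| contractible_add_point (G : space) (A : {set G}) :
    contractible G -> contractible (sub A) -> contractible (add_point A)
| contractible_del_edge (G : space) (v u : G) :
    contractible G -> adj v u -> contractible (sub (rim2 v u)) ->
    contractible (del_edge v u)
| contractible_add_edge (G : space) (v u : G) :
    contractible G -> v != u -> ~~ adj v u ->
    contractible (sub (rim2 v u)) -> contractible (add_edge v u).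

Definition sphere0 (S : space) : Prop :=
  #|S| = 2 /\ forall x y : S, ~~ adj x y.

Definition sphere1 (S : space) : Prop :=
  connected S /\ forall v : S, sphere0 (sub (rim v)).

(* A space D together with a set dD of points, the boundary; the interior is
   the complement ~: dD. *)
Definition bounded_pred : Type := forall D : space, {set D} -> Prop.

Definition disk0 : bounded_pred := fun D dD => #|D| = 1 /\ dD = set0.

Definition disk1 : bounded_pred := fun D dD =>
  (exists (S : space) (v : S), sphere1 S /\ iso (del_point v) D) /\
  dD = [set x | #|rim x| == 1].

Definition disk_of (disk' : bounded_pred) (sphere' : space -> Prop) :
  bounded_pred := fun D dD =>
  [/\ connected D, contractible D, dD != set0 /\ ~: dD != set0
    & [/\ forall x, x \in dD ->
            exists B : {set sub (rim x)}, disk' (sub (rim x)) B,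
          forall x, x \in ~: dD -> sphere' (sub (rim x))
        & sphere' (sub dD)]].

Definition sphere_of (disk : bounded_pred) (S : space) : Prop :=
  exists (D C : space) (dD : {set D}) (dC : {set C}) (f : D -> C),
  [/\ disk D dD, disk C dC, iso_on f dD dC & iso (glue f dD dC) S].

(* [disk n D dD]: D is a digital n-disk with boundary dD.
   [sphere n.+2] is [sphere_of (disk n.+2)], with [disk n.+2] unfolded so that
   the recursion is structural. *)
Fixpoint disk (n : nat) (D : space) (dD : {set D}) {struct n} : Prop :=
  match n with
  | 0 => disk0 dD
  | m.+1 =>
    match m with
    | 0 => disk1 dD
    | _.+1 => disk_of (disk m) (sphere m) dD
    end
  end
with sphere (n : nat) (S : space) {struct n} : Prop :=
  match n with
  | 0 => sphere0 S
  | m.+1 =>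
    match m with
    | 0 => sphere1 S
    | _.+1 => sphere_of (disk_of (disk m) (sphere m)) S
    end
  end.

Lemma diskSS n (D : space) (dD : {set D}) :
  disk n.+2 dD = disk_of (@disk n.+1) (sphere n.+1) dD.
Proof. by []. Qed.

Lemma sphereSS n (S : space) : sphere n.+2 S = sphere_of (@disk n.+2) S.
Proof. by []. Qed.

Definition manifold (n : nat) (G : space) : Prop :=
  [/\ 0 < n, connected G & forall v : G, sphere n.-1 (sub (rim v))].

(* The subspace of K induced on U is an n-disk with boundary dU; its interior
   is U :\: dU. *)
Definition disk_in (n : nat) (K : space) (U dU : {set K}) : Prop :=
  dU \subset U /\ @disk n (sub U) [set x | val x \in dU].

(* d-transformations of the n-manifold N. *)
Inductive dtransform (n : nat) (N : space) : space -> Prop :=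
| dtransform_contract (U dU : {set N}) (v : N) (M : space) :
    manifold n N -> disk_in n U dU -> v \in U :\: dU ->
    iso (@sub (join v dU) (~: ((U :\: dU) :\ v))) M ->
    dtransform n N M
| dtransform_expand (v : N) (D : space) (dD : {set D}) (f : N -> D)
    (M : space) :
    manifold n N -> disk n dD -> iso_on f (rim v) dD ->
    iso (@del_point (glue f (rim v) dD) (inl v)) M ->
    dtransform n N M.

Inductive dreachable (n : nat) : space -> space -> Prop :=
| dreachable_iso (N M : space) : iso N M -> dreachable n N M
| dreachable_step (N L M : space) :
    dtransform n N L -> dreachable n L M -> dreachable n N M.

Definition equivalent (n : nat) (N M : space) : Prop :=
  [/\ manifold n N, manifold n M & dreachable n N M \/ dreachable n M N].

(* Main.v *)
Require Import Defs.
From mathcomp Require Import all_boot.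
From Stdlib Require Import Classical.

Set Implicit Arguments.
Unset Strict Implicit.
Unset Printing Implicit Defensive.

(* A space is an (n+1)-sphere exactly when it is connected, its rims are
   n-spheres and deleting some point (equivalently, any point) leaves a
   contractible space. Contracting a disk to a point p preserves all three
   conditions in both directions: for a point w outside the disk, adding p as
   the apex of a cone over the disk and then deleting the old interior points
   one by one, each of which has a cone with apex p as its rim, relates the
   contractibility of the complements of w before and after.

   Hence, by induction on the number of points, one may assume that every
   3-disk of H has a single interior point. The disks O(v) - u then force every
   rim O(v) to contain a unique point distinct from and non-adjacent to each of
   its points u. So if v' is the antipode of v in some O(u), all points other
   than v and v' are adjacent to both, and H - v is a cone with apex v'. *)

(** * Subspaces, connectedness and contractibility *)

Lemma iso_sym (G H : space) : iso G H -> iso H G.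
Proof.
case=> f [g fK gK] fadj; exists g; first by exists f.
by move=> x y; rewrite -fadj !gK.
Qed.

Lemma iso_image (G H : space) (f : G -> H) (B : {set H}) :
  injective f -> (forall x y, adj (f x) (f y) = adj x y) ->
  f @: [set: G] = B -> iso G (sub B).
Proof.
move=> finj fadj fB.
have fP x : f x \in B by rewrite -fB imset_f.
pose g x : sub B := Sub (f x) (fP x).
have ginj : injective g by move=> x y [/finj].
exists g; last by move=> x y; rewrite /= /sub_adj /= fadj.
apply: inj_card_bij ginj _.
by rewrite card_sig /= -fB (leq_trans (leq_imset_card _ _)) // cardsT.
Qed.

(** * Transport along embeddings *)

Section Embeddings.
Variables (G H : space) (f : G -> H) (A : {set G}).

(** Values of [f] outside [A] are ignored, so conditions on sets of points move between ambient
    spaces without passing to subtypes. *)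
Definition embeds : Prop :=
  {in A &, injective f} /\ {in A &, forall x y, adj (f x) (f y) = adj x y}.

Lemma embeds_iso : embeds -> iso (sub A) (sub (f @: A)).
Proof.
case=> finj fadj; apply: (iso_image (f := fun x : sub A => f (val x))).
- by move=> x y /finj e; apply/val_inj/e; apply: valP.
- by move=> [x xA] [y yA]; rewrite fadj.
apply/setP=> y; apply/imsetP/imsetP => [[x _ ->]|[x xA ->]].
  by case: x => x xA; exists x.
by exists (Sub x xA).
Qed.

Lemma embeds_rim x : embeds -> x \in A ->
  (f @: A) :&: rim (f x) = f @: (A :&: rim x).
Proof.
case=> finj fadj xA; apply/setP=> y; rewrite !inE; apply/andP/imsetP.
  by case=> /imsetP[z zA ->]; rewrite fadj // => xz; exists z; rewrite ?inE ?zA.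
by case=> z /setIP[zA]; rewrite inE => xz ->; rewrite imset_f // fadj.
Qed.

Lemma embeds_setD1 x : embeds -> x \in A -> (f @: A) :\ f x = f @: (A :\ x).
Proof.
case=> finj fadj xA; apply/setP=> y; rewrite !inE; apply/andP/imsetP.
  case=> yx /imsetP[z zA ez]; exists z => //; rewrite !inE zA andbT.
  by apply: contraNneq yx => <-; rewrite ez.
case=> z; rewrite !inE => /andP[zx zA] ->; rewrite imset_f //; split=> //.
by apply: contraNneq zx => /finj->.
Qed.
End Embeddings.

Lemma embedsS (G H : space) (f : G -> H) (A B : {set G}) :
  B \subset A -> embeds f A -> embeds f B.
Proof.
by move=> /subsetP sBA [i a]; split=> x y /sBA xA /sBA yA; [apply: i|apply: a].
Qed.

Lemma embeds_val (G : space) (A : {set G}) (B : {set sub A}) :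
  embeds (val : sub A -> G) B.
Proof. by split=> // x y _ _; apply: val_inj. Qed.

Lemma embeds_Some (G : space) (A B : {set G}) :
  embeds (Some : G -> add_point A) B.
Proof. by split=> // x y _ _ []. Qed.

(* Connectedness as an induction principle: a property that spreads along the
   edges of A and holds somewhere in A holds on all of A. *)
Definition conn (G : space) (A : {set G}) : Prop :=
  (exists x, x \in A) /\ forall P : G -> Prop, (exists2 x, x \in A & P x) ->
    (forall x y, x \in A -> y \in A -> adj x y -> P x -> P y) ->
    forall y, y \in A -> P y.

Definition ctr (G : space) (A : {set G}) : Prop := contractible (sub A).

Lemma ctr_embeds (G H : space) (f : G -> H) (A : {set G}) :
  embeds f A -> ctr (f @: A) <-> ctr A.
Proof.
move=> /embeds_iso fA; split=> c; apply: (contractible_iso c) => //.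
exact: iso_sym.
Qed.

Lemma conn_embeds (G H : space) (f : G -> H) (A : {set G}) :
  embeds f A -> conn (f @: A) <-> conn A.
Proof.
case=> finj fadj; split=> [[ne cA]|[ne cA]]; split.
- by case: ne => _ /imsetP[x xA _]; exists x.
- move=> P [x xA Px] Pcl y yA.
  have [] // := cA (fun z => exists2 x, x \in A & z = f x /\ P x) _ _ (f y).
  + by exists (f x); [apply: imset_f | exists x].
  + move=> _ _ /imsetP[a aA ->] /imsetP[b bA ->]; rewrite fadj // => ab.
    case=> a' a'A [/finj<- // Pa]; exists b => //; split=> //.
    exact: Pcl ab Pa.
  + exact: imset_f.
  by move=> z zA [/finj->].
- by case: ne => x xA; exists (f x); apply: imset_f.
move=> P [_ /imsetP[x xA ->] Pfx] Pcl _ /imsetP[y yA ->].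
apply: (cA (fun z => P (f z))) yA; first by exists x.
by move=> a b aA bA ab; apply: Pcl; rewrite ?imset_f ?fadj.
Qed.

Lemma connectedP (G : space) : connected G <-> conn [set: G].
Proof.
split=> [[ne cG]|[[x _] cG]]; split.
- by have /card_gt0P[x _] := ne; exists x.
- move=> P [x _ Px] Pcl y _; have /connectP[p] := cG x y.
  elim: p x Px => [|z p IH] x Px /=; first by move=> _ ->.
  by case/andP=> xz; apply/IH/(Pcl x).
- by apply/card_gt0P; exists x.
move=> y z; apply: (cG (fun z => connect (@adj G) y z)) => //.
  by exists y; rewrite ?inE.
by move=> a b _ _ ab /connect_trans; apply; apply: connect1.
Qed.

Lemma val_setT (G : space) (A : {set G}) : val @: [set: sub A] = A.
Proof.
apply/setP=> y; apply/imsetP/idP => [[x _ ->]|yA]; first exact: valP.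
by exists (Sub y yA).
Qed.

(** * Contractible transformations inside an ambient space *)

Section Contractible.
Variable G : space.
Implicit Types (A : {set G}) (x y : G).

Lemma ctr_add x A : x \notin A -> ctr A -> ctr (A :&: rim x) -> ctr (x |: A).
Proof.
move=> xA cA cR; pose B : {set sub A} := [set y | adj x (val y)].
have vB : val @: B = A :&: rim x.
  apply/setP=> y; rewrite !inE; apply/imsetP/andP.
    by case=> z; rewrite inE => xz ->; split=> //; apply: valP.
  by case=> yA xy; exists (Sub y yA); rewrite ?inE.
have cB : contractible (sub B).
  by apply/(ctr_embeds (embeds_val B)); rewrite vB.
apply: contractible_iso (contractible_add_point cA cB) _.
pose h (o : add_point B) := if o is Some y then val y else x.
apply: (@iso_image _ _ h).
- case=> [a|] [b|] //= e; first by congr Some; apply: val_inj.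
    by move: xA; rewrite -e (valP a).
  by move: xA; rewrite e (valP b).
- by case=> [a|] [b|] //=; rewrite ?inE ?adj_irr // adj_sym.
apply/setP=> y; rewrite !inE; apply/imsetP/orP.
  by case=> [[a|] _ ->]; [right; apply: valP | left].
by case=> [/eqP->|yA]; [exists None | exists (Some (Sub y yA))].
Qed.

Lemma ctr_del x A : x \in A -> ctr A -> ctr (A :&: rim x) -> ctr (A :\ x).
Proof.
move=> xA cA cR; pose v : sub A := Sub x xA.
have vB : val @: rim v = A :&: rim x.
  have := embeds_rim (embeds_val [set: sub A]) (in_setT v).
  by rewrite val_setT setTI => <-.
have cB : contractible (sub (rim v)).
  by apply/(ctr_embeds (embeds_val (rim v))); rewrite vB.
have := proj2 (ctr_embeds (embeds_val _)) (contractible_del_point cA cB).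
by rewrite -setTD -(embeds_setD1 (embeds_val _)) ?inE // val_setT.
Qed.

Lemma ctr1 x : ctr [set x].
Proof. by apply: contractible_K1; rewrite card_sig cards1. Qed.

(** For [y] other than the apex, both [A :\ y] and [A :&: rim y] are smaller cones with the same
    apex, so [y] can be added last. *)
Lemma ctr_cone x A : x \in A -> A :\ x \subset rim x -> ctr A.
Proof.
have [n] := ubnP #|A|; elim: n A => // n IH A /ltnSE leAn xA sA.
have [e|/set0Pn[y yA]] := eqVneq (A :\ x) set0.
  by rewrite -(setD1K xA) e setU0; apply: ctr1.
have yx := subsetP sA _ yA; move: (yA) (yx); rewrite !inE => /andP[nyx yA'] xy.
have lt : #|A :\ y| < #|A| by rewrite [X in _ < X](cardsD1 y) yA'.
rewrite -(setD1K yA'); apply: ctr_add; first by rewrite !inE eqxx.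
  apply: IH; rewrite ?inE ?xA 1?eq_sym ?nyx ?(leq_trans lt) //.
  by apply: subset_trans sA; rewrite setSD // subsetDl.
apply: IH.
- by apply: leq_trans leAn; apply: leq_ltn_trans lt; rewrite subset_leq_card ?subsetIl.
- by rewrite !inE xA eq_sym nyx adj_sym xy.
by apply: subset_trans sA; rewrite setSD // subIset // subsetDl.
Qed.

End Contractible.

(** * Spheres and disks as sets of points of an ambient space *)

(* The contractibility clause stands for the gluing of two disks in [sphere],
   so that a sphere can be handled without leaving its ambient space; see
   [sphereP]. *)
Fixpoint sph (n : nat) (G : space) (A : {set G}) {struct n} : Prop :=
  if n is m.+1 then
    [/\ conn A, forall x, x \in A -> sph m (A :&: rim x)
      & forall x, x \in A -> ctr (A :\ x)]
  else #|A| = 2 /\ {in A &, forall x y, ~~ adj x y}.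

(** The index is the dimension of the rims: [mfd n] corresponds to [manifold n.+1]. *)
Definition mfd (n : nat) (G : space) (A : {set G}) : Prop :=
  conn A /\ forall x, x \in A -> sph n (A :&: rim x).

(** The clause of [disk_of] is used from dimension 1 on, in place of the punctured circle of
    [disk1]; [disk1P] reconciles the two. *)
Fixpoint dsk (n : nat) (G : space) (A B : {set G}) {struct n} : Prop :=
  if n is m.+1 then
    [/\ B \subset A, conn A /\ ctr A,
        (exists x, x \in B) /\ (exists2 x, x \in A & x \notin B)
      & [/\ forall x, x \in B -> exists C, dsk m (A :&: rim x) C,
            forall x, x \in A -> x \notin B -> sph m (A :&: rim x)
          & sph m B]]
  else #|A| = 1 /\ B = set0.

Lemma sph_mfd n (G : space) (A : {set G}) : sph n.+1 A -> mfd n A.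
Proof. by case. Qed.

Lemma dsk_sub n (G : space) (A B : {set G}) : dsk n A B -> B \subset A.
Proof. by case: n => [|n] []// _ ->; apply: sub0set. Qed.

Lemma sph_ne n (G : space) (A : {set G}) : sph n A -> exists x, x \in A.
Proof.
case: n => [[c _]|n [[]]//].
by apply/set0Pn; rewrite -cards_eq0 c.
Qed.

(** The rim of a boundary point would again be both a disk and a sphere, one dimension lower; in
    dimension 0 the cardinalities 1 and 2 differ. *)
Lemma dsk_not_sph n (G : space) (A B : {set G}) : dsk n A B -> sph n A -> False.
Proof.
elim: n A B => [|n IH] A B; first by case=> c1 _ [c2 _]; rewrite c1 in c2.
case=> sBA _ [[x xB] _] [/(_ x xB)[C dC] _ _] [_ /(_ x) s _].
by apply: IH dC (s _); apply: (subsetP sBA).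
Qed.

(** By induction the rim in [A] of a point of [A] is its whole rim in [S], so [A] is closed under
    adjacency in the connected set [S]. *)
Lemma sph_inj n (G : space) (A S : {set G}) :
  sph n S -> sph n A -> A \subset S -> A = S.
Proof.
elim: n A S => [|n IH] A S.
  by move=> [cS _] [cA _] sAS; apply/eqP; rewrite eqEcard sAS cA cS.
move=> [[_ cS] rS _] [[[x xA] _] rA _] sAS; apply/eqP.
rewrite eqEsubset sAS /=; apply/subsetP; apply: cS.
  by exists x; rewrite ?(subsetP sAS).
move=> y z yS zS yz yA; have : z \in S :&: rim y by rewrite !inE zS.
by rewrite -(IH _ _ (rS _ yS) (rA _ yA) (setSI _ sAS)) => /setIP[].
Qed.

Lemma conn_rim (G : space) (A : {set G}) x y :
  conn A -> x \in A -> y \in A -> y != x -> exists z, z \in A :&: rim x.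
Proof.
move=> [_ cA] xA yA yx; have [e|/set0Pn//] := eqVneq (A :&: rim x) set0.
suff e' : y = x by rewrite e' eqxx in yx.
apply: (cA (fun z => z = x)) yA; first by exists x.
move=> a b aA bA ab ax; move: ab; rewrite ax => ab.
have : b \in A :&: rim x by rewrite !inE bA.
by rewrite e inE.
Qed.

(** In positive dimension such a point is found, by induction, in the rim of any neighbour of
    [x]. *)
Lemma sph_antipode n (G : space) (A : {set G}) x :
  sph n A -> x \in A -> exists y, [/\ y \in A, y != x & ~~ adj x y].
Proof.
elim: n A x => [|n IH] A x.
  case=> cA aA xA; have /card_gt0P[y] : 0 < #|A :\ x|.
    by move: cA; rewrite (cardsD1 x) xA add1n => -[->].
  by rewrite !inE => /andP[yx yA]; exists y; split=> //; apply: aA.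
case=> cA rA _ xA.
have [y /setIP[yA]] := sph_ne (rA _ xA); rewrite inE => xy.
have [|z [/setIP[zA _] zx xz]] := IH _ x (rA _ yA); last by exists z.
by rewrite !inE xA adj_sym.
Qed.

(** Contractibility of the punctured set passes along an edge from [a] to [b]: delete [b] from
    [S :\ a], then put [a] back. Both rims involved are punctured rims of [S]. *)
Lemma ctr_transfer n (G : space) (S : {set G}) x y :
  mfd n S -> (forall z w, z \in S -> w \in S :&: rim z ->
     ctr (S :&: rim z :\ w)) ->
  x \in S -> ctr (S :\ x) -> y \in S -> ctr (S :\ y).
Proof.
case=> [[_ cS] rS] rc xS cx; apply: (cS (fun y => ctr (S :\ y))).
  by exists x.
move=> a b aS bS ab ca.
have ba : b != a by apply: contraTneq ab => ->; rewrite adj_irr.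
have := @ctr_del _ b _ _ ca; rewrite !inE ba bS => /(_ isT).
rewrite setIDAC => /(_ (rc _ _ bS _)).
rewrite !inE aS adj_sym ab => /(_ isT) cab.
have -> : S :\ b = a |: (S :\ a :\ b).
  apply/setP=> z; rewrite !inE; case: (eqVneq z a) => [->|] //=.
  by rewrite aS eq_sym ba.
apply: ctr_add => //; first by rewrite !inE eqxx andbF.
have -> : (S :\ a :\ b) :&: rim a = S :&: rim a :\ b.
  apply/setP=> z; rewrite !inE; case: (eqVneq z a) => [->|_] /=; first by rewrite adj_irr !andbF.
  by rewrite andbA.
by apply: rc; rewrite ?inE ?bS.
Qed.

Lemma sph_ctr_setD1 n (G : space) (A : {set G}) x :
  sph n A -> x \in A -> ctr (A :\ x).
Proof.
case: n => [[cA _] xA|n [_ _]]; last exact.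
have /cards1P[y ->] : #|A :\ x| == 1 by move: cA; rewrite (cardsD1 x) xA add1n => -[->].
exact: ctr1.
Qed.

Lemma mfd_sph n (G : space) (S : {set G}) x :
  mfd n S -> x \in S -> ctr (S :\ x) -> sph n.+1 S.
Proof.
move=> mS xS cx; have [cS rS] := mS; split=> // y.
by apply: (ctr_transfer mS _ xS cx) => z w zS; apply: sph_ctr_setD1 (rS _ zS).
Qed.

(* The boundary of the rim of a boundary point, existential in the definition,
   is determined because a sphere inside a sphere of the same dimension is the
   whole sphere. *)
Lemma dsk_bd n (G : space) (A B C : {set G}) x :
  dsk n.+1 A B -> x \in B -> dsk n (A :&: rim x) C -> C = B :&: rim x.
Proof.
case: n => [|n].
  case=> _ _ _ [_ _ [_ aB]] xB [_ ->]; apply/setP=> y; rewrite !inE.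
  by apply/esym/negP => /andP[yB]; apply/negP/aB.
move=> [sBA _ _ [dB iA sB]] xB dC; have [sCA _ _ [dC' _ sC]] := dC.
apply: sph_inj sC _; first by case: sB => _ /(_ x xB).
apply/subsetP=> y yC; move: (subsetP sCA _ yC); rewrite !inE => /andP[yA xy].
(* If [y] were interior, its rim in [A] would be a sphere containing [x], so the common rim of [x]
   and [y] would be a sphere; as [y] lies in [C], it is also a disk. *)
rewrite xy andbT; apply/negPn/negP => yB.
have [_ /(_ x) s _] := iA _ yA yB; have [D dD] := dC' _ yC.
apply: dsk_not_sph dD _; rewrite setIAC; apply: s.
by rewrite !inE adj_sym xy (subsetP sBA).
Qed.

Lemma dsk_rim n (G : space) (A B : {set G}) x :
  dsk n.+1 A B -> x \in B -> dsk n (A :&: rim x) (B :&: rim x).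
Proof.
move=> dA xB; have [_ _ _ [/(_ x xB)[C dC] _ _]] := dA.
by rewrite -(dsk_bd dA xB dC).
Qed.

(** The rim of [y] in [E] is a sphere inside the sphere [S :&: rim y], hence all of it by
    [sph_inj]. *)
Lemma dsk_int_closed n (G : space) (S E B : {set G}) y :
  (forall x, x \in S -> sph n (S :&: rim x)) -> dsk n.+1 E B -> E \subset S ->
  y \in E -> y \notin B -> S :&: rim y \subset E.
Proof.
move=> rS [_ _ _ [_ iE _]] sES yE yB; have sy := iE _ yE yB.
by rewrite -(sph_inj (rS _ (subsetP sES _ yE)) sy) ?subsetIl ?setSI.
Qed.

(** If [E] were all of [S], the rim of a boundary point would be both a disk and a sphere. *)
Lemma dsk_proper n (G : space) (S E B : {set G}) :
  (forall x, x \in S -> sph n (S :&: rim x)) -> dsk n.+1 E B -> E \subset S ->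
  exists2 w, w \in S & w \notin E.
Proof.
move=> rS [sBE _ [[x xB] _] [/(_ x xB)[C dC] _ _]] sES.
have [e|/set0Pn[w]] := eqVneq (S :\: E) set0; last first.
  by rewrite inE => /andP[]; exists w.
have eS : S = E by apply/eqP; rewrite eqEsubset sES andbT -setD_eq0 e.
case: (dsk_not_sph dC); rewrite -eS; apply: rS.
by rewrite (subsetP sES) // (subsetP sBE).
Qed.

Lemma conn_cone (G : space) (A : {set G}) x :
  x \in A -> A :\ x \subset rim x -> conn A.
Proof.
move=> xA sA; split; first by exists x.
have xP y : y \in A -> y != x -> adj x y.
  by move=> yA yx; have := subsetP sA y; rewrite !inE yx yA => ->.
move=> P [y yA Py] Pcl.
have Px : P x.
  have [<- //|yx] := eqVneq y x; apply: Pcl Py => //.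
  by rewrite adj_sym xP.
by move=> z zA; have [-> //|zx] := eqVneq z x; apply: Pcl Px; rewrite ?xP.
Qed.

(** * Cones over disk boundaries and spheres *)

Section Cap.
Variables (G : space) (p : G).

Lemma conn_cap (X : {set G}) :
  conn X -> (exists z, z \in X :&: rim p) -> conn (p |: X).
Proof.
move=> [_ cX] [z /setIP[zX]]; rewrite inE => pz.
split; first by exists p; rewrite setU11.
move=> P [y yX Py] Pcl.
have cl a : a \in X -> P a -> forall b, b \in p |: X -> P b.
  move=> aX Pa; have PX : forall b, b \in X -> P b.
    apply: cX; first by exists a.
    by move=> u v uX vX; apply: Pcl; rewrite !inE ?uX ?vX orbT.
  move=> b /setU1P[->|]; last exact: PX.
  by apply: (Pcl z); rewrite ?inE ?eqxx ?zX ?orbT // ?[adj z p]adj_sym //; apply: PX.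
case/setU1P: (yX) => [ey|]; last by move=> y'; apply: cl Py.
apply: (cl z) => //; apply: (Pcl y) => //; first by rewrite !inE zX orbT.
by rewrite ey.
Qed.

Lemma setU1_rim (X : {set G}) x : x \in rim p -> (p |: X) :&: rim x = p |: (X :&: rim x).
Proof.
rewrite inE => px; apply/setP=> y; rewrite !inE.
by case: eqP => //= ->; rewrite adj_sym px.
Qed.

Lemma setU1_rimN (X : {set G}) x : x \notin rim p -> (p |: X) :&: rim x = X :&: rim x.
Proof.
rewrite inE => px; apply/setP=> y; rewrite !inE.
by case: eqP => //= ->; rewrite adj_sym (negPf px) andbF.
Qed.

Lemma setU1_rim_self (X : {set G}) : (p |: X) :&: rim p = X :&: rim p.
Proof. by apply: setU1_rimN; rewrite inE adj_irr. Qed.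

Lemma sph_pair z : ~~ adj p z -> p != z -> sph 0 [set p; z].
Proof.
move=> pz npz; split; first by rewrite cards2 npz.
by move=> x y /set2P[]-> /set2P[]->; rewrite ?adj_irr // adj_sym.
Qed.

(** Puncturing at [p] gives back the contractible [X], so only rims need attention: that of [p] is
    [Z], and that of a point of [Z] is a capped rim disk, a sphere by induction. *)
Lemma dsk_cap n (X Z : {set G}) :
  dsk n.+1 X Z -> p \notin X -> X :&: rim p = Z -> sph n.+1 (p |: X).
Proof.
elim: n X Z => [|n IH] X Z dX pX eZ; have [sZX [cX tX] [neZ _] [_ iX sZ]] := dX.
  apply: (@mfd_sph _ _ _ p); rewrite ?setU11 ?setU1K //.
  split=> [|x]; first by apply: conn_cap; rewrite ?eZ.
  case/setU1P=> [->|xX]; first by rewrite setU1_rim_self eZ.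
  have [px|px] := boolP (x \in rim p); last first.
    rewrite setU1_rimN //; apply: iX => //.
    by rewrite -eZ !inE xX; move: px; rewrite inE.
  have xZ : x \in Z by rewrite -eZ inE xX.
  rewrite setU1_rim //; have [/eqP/cards1P[z e] _] := dsk_rim dX xZ.
  have : z \in X :&: rim x by rewrite e set11.
  rewrite !inE => /andP[zX xz]; rewrite e; apply: sph_pair.
    apply/negP=> pz; have [_ /(_ x z xZ)] := sZ; rewrite xz.
    by rewrite -eZ !inE zX pz => /(_ isT).
  by apply: contraNneq pX => ->.
apply: (@mfd_sph _ _ _ p); rewrite ?setU11 ?setU1K //.
split=> [|x]; first by apply: conn_cap; rewrite ?eZ.
case/setU1P=> [->|xX]; first by rewrite setU1_rim_self eZ.
have [px|px] := boolP (x \in rim p); last first.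
  rewrite setU1_rimN //; apply: iX => //.
  by rewrite -eZ !inE xX; move: px; rewrite inE.
have xZ : x \in Z by rewrite -eZ inE xX.
rewrite setU1_rim //; apply: IH (dsk_rim dX xZ) _ _.
  by rewrite inE (negPf pX).
by rewrite setIAC eZ.
Qed.

Lemma dsk_ball n (A : {set G}) :
  sph n A -> A \subset rim p -> dsk n.+1 (p |: A) A.
Proof.
elim: n A => [|n IH] A sA Ap.
all: have pA : p \notin A by apply/negP=> /(subsetP Ap); rewrite inE adj_irr.
all: have sub : (p |: A) :\ p \subset rim p by rewrite setU1K.
all: split; [exact: subsetUr | | split | split=> //].
all: try by [split; [apply: (@conn_cone _ _ p) | apply: (@ctr_cone _ p)]; rewrite ?setU11].
all: try by [exact: sph_ne sA].
all: try by [exists p; rewrite ?setU11].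
all: try (move=> x /setU1P[->|-> //] _; rewrite setU1_rim_self; by rewrite (setIidPl Ap)).
- move=> x xA; exists set0; split=> //; rewrite setU1_rim ?(subsetP Ap) //.
  have -> : A :&: rim x = set0.
    apply/setP=> y; rewrite !inE; apply/negP=> /andP[yA].
    by case: sA => _ /(_ x y xA yA) /negP.
  by rewrite setU0 cards1.
move=> x xA; exists (A :&: rim x); rewrite setU1_rim ?(subsetP Ap) //.
apply: IH; first by case: sA => _ /(_ x xA).
by apply: subset_trans Ap; apply: subsetIl.
Qed.

End Cap.

(** * Paths and cycles *)

Section Cycles.
Variable G : space.
Implicit Types (A C : {set G}) (a x y : G).

(** Such an [A] is a path with endpoint [a]. Removing [a] makes its only neighbour [z] an endpoint
    of a shorter path, whose far endpoint, or [z] itself if nothing else is left, is the second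
    endpoint of [A]. *)
Lemma chain_ctr A a : conn A -> (forall y, y \in A -> #|A :&: rim y| <= 2) ->
  a \in A -> #|A :&: rim a| <= 1 ->
  ctr A /\ ((exists y, y \in A :\ a) ->
            exists b, [/\ b \in A, b != a & #|A :&: rim b| <= 1]).
Proof.
have [n] := ubnP #|A|; elim: n A a => // n IH A a /ltnSE leAn cA dA aA da.
have [e|/set0Pn[z zAa]] := eqVneq (A :&: rim a) set0.
  have eA : A = [set a].
    apply/setP=> y; rewrite inE; apply/idP/eqP => [yA|-> //].
    apply/eqP/negPn/negP => ya; have [z] := conn_rim cA aA yA ya.
    by rewrite e inE.
  split; first by rewrite eA; apply: ctr1.
  by rewrite eA => -[y]; rewrite !inE andNb.
have eAa : A :&: rim a = [set z].
  by apply/esym/eqP; rewrite eqEcard sub1set zAa cards1.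
have aP v : v \in A -> adj a v -> v = z.
  by move=> vA av; apply/set1P; rewrite -eAa !inE vA.
move: (zAa); rewrite !inE => /andP[zA az].
have za : z != a by apply: contraTneq az => ->; rewrite adj_irr.
pose A' := A :\ a.
have zA' : z \in A' by rewrite !inE za.
have lt : #|A'| < #|A| by rewrite [X in _ < X](cardsD1 a) aA.
have cA' : conn A'.
  split; first by exists z.
  move=> P [y0 y0A' Py0] Pcl y yA'; have [_ cA2] := cA.
  have inA' w : w \in A' = (w != a) && (w \in A) by rewrite !inE.
  (* Reading [a] as its only neighbour [z] turns a walk in [A] into one in [A']. *)
  have := cA2 (fun w => P (if w == a then z else w)) _ _ y.
  move: yA'; rewrite inA' => /andP[/negPf-> yA]; apply=> //.
    by move: y0A'; rewrite inA' => /andP[/negPf ny y0A]; exists y0; rewrite ?ny.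
  move=> u v uA vA uv.
  have [eu|nu] := eqVneq u a; have [ev|nv] := eqVneq v a => //.
  - by rewrite eu in uv; rewrite -(aP v).
  - by rewrite ev adj_sym in uv; rewrite -(aP u).
  by apply: Pcl uv; rewrite inA' ?nu ?nv.
have leA' y : #|A' :&: rim y| <= #|A :&: rim y|.
  by apply/subset_leq_card/setSI/subsetDl.
have dz : #|A' :&: rim z| <= 1.
  have := dA z zA; rewrite (cardsD1 a) !inE aA adj_sym az /= add1n ltnS.
  by rewrite setIDAC.
have [ctA' hA'] : ctr A' /\ ((exists y, y \in A' :\ z) ->
            exists b, [/\ b \in A', b != z & #|A' :&: rim b| <= 1]).
  apply: IH => //; first exact: leq_trans leAn.
  by move=> y /setD1P[_ yA]; apply: leq_trans (leA' y) (dA y yA).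
split.
  rewrite -(setD1K aA); apply: ctr_add; rewrite ?setD11 //.
  suff -> : A' :&: rim a = [set z] by apply: ctr1.
  rewrite setIDAC eAa; apply/setP=> y; rewrite !inE.
  by case: (eqVneq y z) => [->|]; rewrite ?za ?andbF.
move=> _; have [e|/set0Pn/hA'[b [bA' bz db]]] := eqVneq (A' :\ z) set0.
  exists z; split=> //; rewrite -(cards1 a).
  apply/subset_leq_card/subsetP=> y; rewrite !inE => /andP[yA zy].
  apply/negPn/negP => ya; have : y \in A' :\ z; last by rewrite e inE.
  by rewrite !inE ya yA !andbT; apply: contraTneq zy => ->; rewrite adj_irr.
move: (bA'); rewrite !inE => /andP[ba bA]; exists b; split=> //.
suff <- : A' :&: rim b = A :&: rim b by [].
apply/setP=> y; rewrite !inE; case: eqVneq => //= ->; apply/esym/negP.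
by rewrite adj_sym => /andP[_ /(aP b bA)] eb; rewrite eb eqxx in bz.
Qed.

(* If the second neighbour of x were not in the component of the first one in
   A :\ x, that component would be a path with a single endpoint. *)
Lemma cycle_setD1 A x : mfd 0 A -> x \in A -> conn (A :\ x) /\ ctr (A :\ x).
Proof.
move=> [[_ cA] rA] xA; have [cx aO] := rA x xA.
have /eqP/cards2P[a [b [ab eO]]] := cx; set A' := A :\ x.
have inA' w : w \in A' = (w != x) && (w \in A) by rewrite !inE.
have OP w : w \in A -> adj x w = (w == a) || (w == b).
  by move=> wA; have /setP/(_ w) := eO; rewrite !inE wA.
have /andP[aA xa] : (a \in A) && adj x a.
  by have /setP/(_ a) := eO; rewrite !inE eqxx.
have ax : a != x by apply: contraTneq xa => ->; rewrite adj_irr.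
have aA' : a \in A' by rewrite inA' ax.
(* [e] is adjacency inside [A'], and [C] is the component of [a] there. *)
pose e y z := [&& adj y z, y \in A' & z \in A'].
have e_sym : symmetric e by move=> y z; rewrite /e adj_sym [(y \in _) && _]andbC.
pose C := [set y | connect e a y].
have aC : a \in C by rewrite inE.
have Ccl y z : y \in C -> e y z -> z \in C.
  by rewrite !in_set => ay yz; apply: connect_trans ay (connect1 yz).
have sCA' : C \subset A'.
  apply/subsetP=> y; rewrite in_set => /connectP[p].
  suff: forall u, u \in A' -> path e u p -> y = last u p -> y \in A' by apply.
  elim: p => [|z p IH] u uA' /=; first by move=> _ ->.
  by case/andP=> /and3P[_ _ zA']; apply: IH.
have cC : conn C.
  split; first by exists a.
  move=> P [y0 y0C Py0] Pcl y yC.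
  have /connectP[p] : connect e y0 y.
    move: y0C yC; rewrite !in_set (sym_connect_sym e_sym).
    exact: connect_trans.
  elim: p y0 y0C Py0 => [|z p IH] u uC Pu /=; first by move=> _ ->.
  case/andP=> uz; apply: IH; first exact: Ccl uz.
  by apply: Pcl Pu => //; [apply: Ccl uz | case/andP: uz].
have rC y : y \in C -> C :&: rim y = A' :&: rim y.
  move=> yC; apply/setP=> z; rewrite !in_setI; apply/andP/andP=> -[zC yz].
    by split=> //; apply: (subsetP sCA').
  split=> //; apply: (Ccl y) => //; rewrite /e zC (subsetP sCA') // !andbT.
  by rewrite inE in yz.
have dA y : y \in A -> #|A :&: rim y| = 2 by case/rA.
have rA' y : A' :&: rim y = A :&: rim y :\ x by rewrite setIDAC.
have A'A y : y \in A' -> y \in A by rewrite inA' => /andP[].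
have ra : #|A' :&: rim a| = 1.
  have := dA a aA; rewrite (cardsD1 x) !inE xA adj_sym xa add1n => -[<-].
  by rewrite rA'.
have [||ctC hC] := chain_ctr cC _ aC.
- move=> y yC; rewrite rC // rA' -(dA y) ?A'A ?(subsetP sCA') //.
  by rewrite subset_leq_card ?subsetDl.
- by rewrite rC // ra.
have bC : b \in C.
  apply/negPn/negP => bC; have [|b' [b'C b'a]] := hC.
    have /card_gt0P[y] : 0 < #|A' :&: rim a| by rewrite ra.
    rewrite -rC // !inE => /andP[yC ay]; exists y; rewrite !inE yC andbT.
    by apply: contraTneq ay => ->; rewrite adj_irr.
  have b'A' := subsetP sCA' _ b'C; have b'A := A'A _ b'A'.
  (* Being neither [a] nor [b], the endpoint [b'] is not adjacent to [x] and keeps both its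
     neighbours. *)
  rewrite rC // rA'; have := dA b' b'A; rewrite (cardsD1 x) !inE xA /=.
  rewrite adj_sym OP // (negPf b'a) /=.
  have [eb|_] := eqVneq b' b; first by rewrite -eb b'C in bC.
  by rewrite add0n => ->.
have eC : C = A'.
  apply/eqP; rewrite eqEsubset sCA'; apply/subsetP=> y yA'.
  have [||ey|//] := cA (fun w => w = x \/ w \in C) _ _ y (A'A _ yA').
  - by exists x => //; left.
  - move=> u v uA vA uv [eu|uC].
      by right; move: uv; rewrite eu OP // => /orP[]/eqP->.
    have [ev|vx] := eqVneq v x; first by left.
    right; apply: (Ccl u) => //; rewrite /e uv [v \in _]inA' vx vA (subsetP sCA') //.
  by move: yA'; rewrite inA' ey eqxx.
by rewrite -eC.
Qed.

End Cycles.

(** A walk through [x] is rerouted through the rim of [x], which is connected from dimension 2 on;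
    dimension 1 is the case of a cycle. *)
Lemma sph_conn_setD1 n (G : space) (S : {set G}) x :
  sph n.+1 S -> x \in S -> conn (S :\ x).
Proof.
case: n => [|n] sS xS; first by case: (cycle_setD1 (sph_mfd sS) xS).
have [[_ cS] rS] := sph_mfd sS; have sR := rS x xS.
have inR z : z \in S :&: rim x = (z \in S) && adj x z by rewrite !inE.
have nx z : z \in S :&: rim x -> z != x.
  by rewrite inR => /andP[_]; apply: contraTneq => ->; rewrite adj_irr.
split.
  have [z zR] := sph_ne sR; exists z; rewrite !inE nx //.
  by move: zR; rewrite inR => /andP[].
move=> P [y0 /setD1P[y0x y0S] Py0] Pcl.
have Pcl' u v : u != x -> v != x -> u \in S -> v \in S -> adj u v -> P u -> P v.
  by move=> ux vx uS vS; apply: Pcl; rewrite !inE ?ux ?vx.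
(* On a walk from [y0] to [x], the point just before the first visit to [x] lies in the rim and
   satisfies [P]. *)
have [z zR Pz] : exists2 z, z \in S :&: rim x & P z.
  pose Q w := (w != x /\ P w) \/ exists2 z, z \in S :&: rim x & P z.
  have [||[]|//] := cS Q _ _ x xS; last by rewrite eqxx.
    by exists y0 => //; left.
  move=> u v uS vS uv [[ux Pu]|]; last by right.
  have [ev|vx] := eqVneq v x; last by left; split=> //; apply: Pcl' uv Pu.
  by right; exists u; rewrite // inR uS -ev adj_sym.
have PR : forall y, y \in S :&: rim x -> P y.
  have [[_ cR] _ _] := sR; apply: cR; first by exists z.
  move=> u v uR vR; apply: Pcl'; rewrite ?nx //.
    by move: uR; rewrite inR => /andP[].
  by move: vR; rewrite inR => /andP[].
move=> y /setD1P[yx yS].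
have [||ey|//] := cS (fun w => w = x \/ P w) _ _ y yS; last by rewrite ey eqxx in yx.
  by exists x => //; left.
move=> u v uS vS uv; have [ev|vx] := eqVneq v x; first by left.
have [eu|ux] := eqVneq u x => -[eu'|Pu]; right.
- by apply: PR; rewrite inR vS -eu.
- by apply: PR; rewrite inR vS -eu.
- by rewrite eu' eqxx in ux.
exact: Pcl' uv Pu.
Qed.

Lemma setD1_notin (T : finType) (A : {set T}) x : x \notin A -> A :\ x = A.
Proof. by move=> xA; apply/setDidPl; rewrite disjoint_sym disjoints1. Qed.

(** The rim in [S :\ x] of a neighbour of [x] is a punctured sphere, a disk by induction; a point
    non-adjacent to [x] makes the interior nonempty. *)
Lemma sph_setD1 n (G : space) (S : {set G}) x :
  sph n.+1 S -> x \in S -> dsk n.+1 (S :\ x) (S :&: rim x).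
Proof.
elim: n S x => [|n IH] S x sS xS;
  have [_ rS] := sph_mfd sS; have [_ _ tS] := sS;
  (split;
   [ apply/subsetP=> z; rewrite !inE => /andP[-> xz]; rewrite andbT;
     by apply: contraTneq xz => ->; rewrite adj_irr
   | by split; [apply: sph_conn_setD1 sS xS | apply: tS]
   | split; first exact: sph_ne (rS x xS);
     have [y [yS yx xy]] := sph_antipode sS xS;
     by exists y; rewrite !inE ?yx ?yS
   | split; [ | | exact: rS x xS]]);
  try (move=> y /setD1P[yx yS]; rewrite !inE yS /= => xy; rewrite setIDAC;
       rewrite setD1_notin; [exact: rS | by rewrite !inE xS adj_sym]);
  move=> y /setIP[yS]; rewrite inE adj_sym => yx.
  exists set0; split=> //; have [cy _] := rS y yS.
  rewrite setIDAC; apply/succn_inj; rewrite -cy [in RHS](cardsD1 x).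
  by rewrite !inE xS yx.
by exists ((S :&: rim y) :&: rim x); rewrite setIDAC; apply: IH; rewrite ?inE ?xS //;
  apply: rS.
Qed.

(** * Contracting a disk to a point *)

Section Contraction.
Variables (G : space) (p : G).
Implicit Types (S X Y Z E B I : {set G}).

(** The point [p] can be added because its rim in [S] is contractible. The rim of each point of [I]
    is then a cone with apex [p], so these points can be removed or restored one at a time. *)
Lemma ctr_contract S I : p \notin S -> ctr (S :&: rim p) -> I \subset S ->
  I \subset rim p -> (forall y, y \in I -> S :&: rim y \subset rim p) ->
  ctr S <-> ctr (p |: (S :\: I)).
Proof.
move=> pS cR sIS sIp hI; have cS : ctr S <-> ctr (p |: S).
  split=> c; first exact: ctr_add.
  by rewrite -(setU1K pS); apply: ctr_del; rewrite ?setU11 ?setU1_rim_self.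
apply: (iff_trans cS) => {cS}.
have [n] := ubnP #|I|; elim: n I sIS sIp hI => // n IH I sIS sIp hI /ltnSE leIn.
have [->|/set0Pn[y yI]] := eqVneq I set0; first by rewrite setD0.
have sI' : I :\ y \subset I by apply: subsetDl.
apply: (iff_trans (IH (I :\ y) _ _ _ _)); try exact: subset_trans sI' _.
- by move=> z /setD1P[_]; apply: hI.
- by apply: leq_trans leIn; rewrite [X in _ < X](cardsD1 y) yI.
have yS := subsetP sIS _ yI; have yp := subsetP sIp _ yI.
have ynp : y != p by apply: contraNneq pS => <-.
set T := p |: _; have yT : y \in T by rewrite !inE eqxx yS orbT.
have cT : ctr (T :&: rim y).
  apply: (@ctr_cone _ p); first by rewrite !inE eqxx adj_sym; move: yp; rewrite inE.
  apply/subsetP=> z /setD1P[zp /setIP[/setU1P[ez|]]]; first by rewrite ez eqxx in zp.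
  by case/setDP=> zS _ zy; apply: (subsetP (hI y yI)); rewrite inE zS.
have -> : p |: (S :\: I) = T :\ y.
  apply/setP=> z; rewrite !inE; case: (eqVneq z y) => [->|_] //=.
  by rewrite (negPf ynp) yI.
split=> c; first exact: ctr_del.
rewrite -(setD1K yT); apply: ctr_add; rewrite ?setD11 //.
by rewrite setIDAC setD1_notin // !inE adj_irr andbF.
Qed.

Lemma conn_setU X Y : conn X -> conn Y -> (exists z, z \in X :&: Y) ->
  conn (X :|: Y).
Proof.
move=> [_ cX] [_ cY] [z /setIP[zX zY]].
split; first by exists z; rewrite inE zX.
move=> P [y yXY Py] Pcl.
have PX u : u \in X -> P u -> forall v, v \in X -> P v.
  move=> uX Pu; apply: cX; first by exists u.
  by move=> a b aX bX; apply: Pcl; rewrite inE ?aX ?bX.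
have PY u : u \in Y -> P u -> forall v, v \in Y -> P v.
  move=> uY Pu; apply: cY; first by exists u.
  by move=> a b aY bY; apply: Pcl; rewrite inE ?aY ?bY orbT.
have Pz : P z by case/setUP: yXY => [yX|yY]; [apply: (PX y) | apply: (PY y)].
by move=> v /setUP[vX|vY]; [apply: (PX z) | apply: (PY z)].
Qed.

Lemma glue_rim X Y Z x : X :&: Y = Z ->
  (forall y z, y \in X -> z \in Y -> adj y z -> y \in Z \/ z \in Z) ->
  x \in X -> x \notin Z -> (X :|: Y) :&: rim x = X :&: rim x.
Proof.
move=> eZ aXY xX xZ; apply/setP=> y; rewrite !inE.
case: (boolP (adj x y)) => xy; rewrite ?andbF // !andbT.
case: (boolP (y \in Y)) => yY; rewrite ?orbF // orbT.
case: (aXY x y xX yY xy) => yZ; first by rewrite yZ in xZ.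
by move: yZ; rewrite -eZ inE => /andP[->].
Qed.

(* The point p, adjacent to exactly the points of Y, serves to contract Y. *)
Lemma glue_step n X Y Z : dsk n.+1 X Z -> dsk n.+1 Y Z -> X :&: Y = Z ->
  (forall x y, x \in X -> y \in Y -> adj x y -> x \in Z \/ y \in Z) ->
  p \notin X :|: Y -> (X :|: Y) :&: rim p = Y ->
  (forall x, x \in Z -> sph n ((X :|: Y) :&: rim x)) -> sph n.+1 (X :|: Y).
Proof.
move=> dX dY eZ aXY pXY eY rZ.
have [sZX [cX _] [[z zZ] [w wX wZ]] [_ iX _]] := dX.
have [sZY [cY tY] _ [_ iY _]] := dY.
have wY : w \notin Y by apply: contra wZ => wY; rewrite -eZ inE wX.
have pX : p \notin X by apply: contra pXY; rewrite inE => ->.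
have rp : X :&: rim p = Z by rewrite -eZ -[in RHS]eY setIA (setIidPl (subsetUl _ _)).
(* Capping [X] by [p] gives a sphere, whose puncture at the interior point [w] of [X] is
   contractible. *)
have [_ _ /(_ w)] := dsk_cap dX pX rp; rewrite !inE wX orbT => /(_ isT) cw.
have wp : w != p by apply: contraNneq pX => <-.
have YP y : y \in Y -> (y \in X :|: Y) && adj p y.
  by move=> yY; have /setP/(_ y) := eY; rewrite inE [y \in rim p]inE yY.
have aYX x y : x \in Y -> y \in X -> adj x y -> x \in Z \/ y \in Z.
  by move=> xY yX; rewrite adj_sym => /(aXY _ _ yX xY)[]; [right|left].
apply: (@mfd_sph _ _ _ w); rewrite ?inE ?wX //.
  split=> [|x]; first by apply: conn_setU => //; exists z; rewrite eZ.
  have [/rZ//|xZ] := boolP (x \in Z); case/setUP => xU.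
    by rewrite (glue_rim eZ aXY) //; apply: iX.
  by rewrite setUC (glue_rim _ aYX) //; [apply: iY | rewrite setIC].
(* Contracting the interior of [Y] to [p] turns the punctured union into the punctured cap. *)
apply/(ctr_contract (I := Y :\: Z)).
- by rewrite inE negb_and pXY orbT.
- rewrite setIDAC eY; by rewrite setD1_notin.
- apply/subsetP=> y /setDP[yY _]; rewrite !inE yY orbT andbT.
  by apply: contraNneq wY => <-.
- by apply/subsetP=> y /setDP[/YP/andP[_ py] _]; rewrite inE.
- move=> y /setDP[yY yZ]; rewrite setIDAC setUC (glue_rim _ aYX) //; last by rewrite setIC.
  apply: subset_trans (subsetDl _ _) _; apply: subset_trans (subsetIl _ _) _.
  by apply/subsetP=> u /YP/andP[_]; rewrite inE.
suff <- : (p |: X) :\ w = p |: (((X :|: Y) :\ w) :\: (Y :\: Z)) by [].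
apply/setP=> y; rewrite !inE; case: (eqVneq y p) => [->|_] /=; first by rewrite eq_sym wp.
case: (eqVneq y w) => //= _; first by rewrite andbF.
rewrite -eZ inE; case: (y \in X); case: (y \in Y) => //.
Qed.

(** The rim of a point [x] of [Z] is itself two disks glued along [Z :&: rim x], with [p] adjacent
    to exactly the second one, so induction applies. In dimension 1 it consists of two points, one
    on each side. *)
Lemma dsk_glue n X Y Z : dsk n.+1 X Z -> dsk n.+1 Y Z -> X :&: Y = Z ->
  (forall x y, x \in X -> y \in Y -> adj x y -> x \in Z \/ y \in Z) ->
  p \notin X :|: Y -> (X :|: Y) :&: rim p = Y -> sph n.+1 (X :|: Y).
Proof.
elim: n X Y Z => [|n IH] X Y Z dX dY eZ aXY pXY eY.
all: apply: (glue_step dX dY) => // x xZ; rewrite setIUl.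
  have [/eqP/cards1P[a ea] _] := dsk_rim dX xZ.
  have [/eqP/cards1P[b eb] _] := dsk_rim dY xZ.
  have [_ _ _ [_ _ [_ aZ]]] := dX.
  have /andP[aX xa] : (a \in X) && adj x a.
    by have /setP/(_ a) := ea; rewrite !inE eqxx.
  have /andP[bY xb] : (b \in Y) && adj x b.
    by have /setP/(_ b) := eb; rewrite !inE eqxx.
  rewrite ea eb; apply: sph_pair.
    apply/negP=> ab; case: (aXY a b aX bY ab) => inZ.
      by have := aZ x a xZ inZ; rewrite xa.
    by have := aZ x b xZ inZ; rewrite xb.
  apply/eqP=> ab; have aZ' : a \in Z by rewrite -eZ inE aX ab.
  by have := aZ x a xZ aZ'; rewrite xa.
apply: IH (dsk_rim dX xZ) (dsk_rim dY xZ) _ _ _ _.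
- by rewrite -setIIl eZ.
- move=> u v /setIP[uX xu] /setIP[vY xv] uv.
  by case: (aXY u v uX vY uv) => inZ; [left|right]; rewrite inE inZ.
- by rewrite -setIUl inE (negPf pXY).
by rewrite -setIUl setIAC eY.
Qed.

(** Here [p] is adjacent in [S] to exactly the points of [E], so trading the interior of [E] for [p]
    contracts the disk and leaves [p] joined to [B] alone. *)
Lemma contract_conn n S E B : mfd n S -> dsk n.+1 E B -> E \subset S ->
  p \notin S -> S :&: rim p = E -> conn (p |: (S :\: (E :\: B))).
Proof.
move=> [[_ cS] rS] dE sES pS eE; have [sBE _ [_ [i iE iB]] _] := dE.
have EP y : y \in S -> adj p y = (y \in E) by move=> yS; rewrite -eE !inE yS.
have IP y : y \in E :\: B = (y \in E) && (y \notin B) by rewrite inE andbC.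
split; first by exists p; rewrite setU11.
(* A property on the contracted set is read on [S] by treating every interior point of [E] as
   [p]. *)
move=> P [y0 y0S' Py0] Pcl; pose Q w := if w \in E :\: B then P p else P w.
have iI : i \in E :\: B by rewrite IP iE.
have QS : forall y, y \in S -> Q y.
  apply: cS.
    case/setU1P: y0S' => [ey0|/setDP[y0S y0I]].
      by exists i; rewrite /Q ?iI -?ey0 // (subsetP sES).
    by exists y0; rewrite /Q ?(negPf y0I).
  have adjp u v : u \in S -> v \in S -> adj u v -> u \in E :\: B ->
      v \notin E :\: B -> adj p v /\ v \in p |: (S :\: (E :\: B)).
    move=> uS vS uv; rewrite IP => /andP[uE uB] vI.
    rewrite EP // !(inE, vI, vS) orbT; split=> //.
    by apply: (subsetP (dsk_int_closed rS dE sES uE uB)); rewrite !inE vS.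
  move=> u v uS vS uv; rewrite /Q.
  case: ifPn => uI; case: ifPn => vI //.
  - by have [pv vS'] := adjp u v uS vS uv uI vI; apply: Pcl; rewrite ?setU11.
  - rewrite adj_sym in uv; have [pv vS'] := adjp v u vS uS uv vI uI.
    by apply: Pcl; rewrite ?setU11 // adj_sym.
  by apply: Pcl => //; rewrite !(inE, uS, vS, uI, vI) orbT.
move=> y /setU1P[->|/setDP[yS yI]].
  by have := QS i (subsetP sES _ iE); rewrite /Q iI.
by have := QS y yS; rewrite /Q (negPf yI).
Qed.

(** Puncturing at a point outside [E] leaves the disk intact, so [ctr_contract] applies to
    [S :\ w]. *)
Lemma contract_ctr n S E B w : mfd n S -> dsk n.+1 E B -> E \subset S ->
  p \notin S -> S :&: rim p = E -> w \in S -> w \notin E ->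
  ctr (S :\ w) <-> ctr ((p |: (S :\: (E :\: B))) :\ w).
Proof.
move=> [_ rS] dE sES pS eE wS wE; have [_ [_ tE] _ _] := dE.
have wp : w != p by apply: contraNneq pS => <-.
have -> : (p |: (S :\: (E :\: B))) :\ w = p |: ((S :\ w) :\: (E :\: B)).
  apply/setP=> y; rewrite !inE.
  case: (eqVneq y p) => [->|_] /=; first by rewrite eq_sym wp.
  by case: (eqVneq y w); rewrite ?andbF.
have sEp : E \subset rim p by rewrite -eE subsetIr.
apply: ctr_contract.
- by rewrite inE negb_and pS orbT.
- rewrite setIDAC eE; by rewrite setD1_notin.
- apply/subsetP=> y /setDP[yE _]; rewrite !inE (subsetP sES) // andbT.
  by apply: contraNneq wE => <-.
- by apply: subset_trans sEp; apply: subsetDl.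
move=> y /setDP[yE yB]; apply: subset_trans sEp.
apply: subset_trans (dsk_int_closed rS dE sES yE yB).
by apply/setSI/subsetDl.
Qed.

Lemma contract_sph_of_mfd n S E B : sph n.+1 S -> dsk n.+1 E B ->
  E \subset S -> p \notin S -> S :&: rim p = E ->
  mfd n (p |: (S :\: (E :\: B))) -> sph n.+1 (p |: (S :\: (E :\: B))).
Proof.
move=> sS dE sES pS eE mS'; have [_ rS tS] := sS.
have [w wS wE] := dsk_proper rS dE sES.
apply: (mfd_sph (x := w)) => //; first by rewrite !(inE, wS, negPf wE) andbF orbT.
exact/(contract_ctr (sph_mfd sS) dE)/tS.
Qed.

(** The rim of [p] becomes [B] and points outside [E] keep their rims, so only the rims of points of
    [B] remain to be checked. *)
Lemma contract_step n S E B : mfd n S -> dsk n.+1 E B -> E \subset S ->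
  p \notin S -> S :&: rim p = E ->
  (forall x, x \in B -> sph n (p |: ((S :\: (E :\: B)) :&: rim x))) ->
  mfd n (p |: (S :\: (E :\: B))).
Proof.
move=> mS dE sES pS eE rB; split; first exact: contract_conn mS dE sES pS eE.
have [_ rS] := mS; have [sBE _ _ [_ _ sB]] := dE.
have EP y : y \in S -> adj p y = (y \in E) by move=> yS; rewrite -eE !inE yS.
move=> x /setU1P[->|/setDP[xS xI]].
  by rewrite setU1_rim_self setIDAC eE setDDr setDv set0U (setIidPr sBE).
have [xE|xE] := boolP (x \in E).
  rewrite setU1_rim ?inE ?EP //; apply: rB.
  by move: xI; rewrite inE xE andbT negbK.
rewrite setU1_rimN ?inE ?EP //.
suff -> : (S :\: (E :\: B)) :&: rim x = S :&: rim x by apply: rS.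
rewrite setIDAC; apply/setDidPl; rewrite disjoint_sym disjoint_subset.
apply/subsetP=> y /setDP[yE yB]; rewrite !inE adj_sym; apply/negP=> /andP[yS yx].
have := subsetP (dsk_int_closed rS dE sES yE yB) x; rewrite !inE xS yx => /(_ isT).
by rewrite (negPf xE).
Qed.

(** At a point [x] of [B] the new rim is the contraction of the sphere [S :&: rim x] along the disk
    [E :&: rim x]: a manifold by induction, hence a sphere by [contract_sph_of_mfd]. *)
Lemma contract_mfd n S E B : mfd n S -> dsk n.+1 E B -> E \subset S ->
  p \notin S -> S :&: rim p = E -> mfd n (p |: (S :\: (E :\: B))).
Proof.
elim: n S E B => [|n IH] S E B mS dE sES pS eE;
  apply: (contract_step mS dE) => // x xB; have [_ rS] := mS;
  have [sBE _ _ [_ _ sB]] := dE; have xE := subsetP sBE _ xB;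
  have xS := subsetP sES _ xE.
  (* In the lowest case [x] has one neighbour [e] in the disk and one, [z], outside; contraction
     replaces [e] by [p]. *)
  have [/eqP/cards1P[e ee] _] := dsk_rim dE xB.
  have [cx _] := rS x xS; have [_ aB] := sB.
  have /andP[eE' xe] : (e \in E) && adj x e.
    by have /setP/(_ e) := ee; rewrite !inE eqxx.
  have eB : e \notin B by apply: contraL xe; apply: aB.
  have : #|S :&: rim x :\ e| == 1.
    by move: cx; rewrite (cardsD1 e) !inE (subsetP sES) ?xe // add1n => -[->].
  case/cards1P=> z ez.
  have : z \in S :&: rim x :\ e by rewrite ez set11.
  rewrite !inE => /and3P[nze zS xz].
  have zE : z \notin E.
    apply/negP=> zE; have : z \in E :&: rim x by rewrite !inE zE.
    by rewrite ee inE (negPf nze).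
  suff -> : (S :\: (E :\: B)) :&: rim x = [set z].
    apply: sph_pair; last by apply: contraNneq pS => ->.
    by apply: contra zE => pz; rewrite -eE !inE zS.
  rewrite -ez; apply/setP=> y; rewrite !inE.
  case: (eqVneq y e) => [->|nye]; first by rewrite eE' eB.
  case: (boolP (adj x y)) => xy; rewrite ?andbF // !andbT.
  case: (boolP (y \in E)) => yE; rewrite ?andbF // andbT.
  have : y \in E :&: rim x by rewrite !inE yE.
  by rewrite ee inE (negPf nye).
have sSx := rS x xS; have dEx := dsk_rim dE xB.
have -> : (S :\: (E :\: B)) :&: rim x =
  (S :&: rim x) :\: ((E :&: rim x) :\: (B :&: rim x)).
  by apply/setP=> y; rewrite !inE; case: (adj x y); rewrite ?andbF // !andbT.
have pSx : p \notin S :&: rim x by rewrite inE negb_and pS.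
have eEx : S :&: rim x :&: rim p = E :&: rim x by rewrite setIAC eE.
apply: (contract_sph_of_mfd sSx dEx) => //; first exact: setSI.
by apply: IH dEx _ _ _ => //; [apply: sph_mfd | apply: setSI].
Qed.

Lemma contract_sph n S E B : mfd n S -> dsk n.+1 E B -> E \subset S ->
  p \notin S -> S :&: rim p = E ->
  sph n.+1 (p |: (S :\: (E :\: B))) -> sph n.+1 S.
Proof.
move=> mS dE sES pS eE [_ _ tS']; have [w wS wE] := dsk_proper mS.2 dE sES.
apply: (mfd_sph mS wS); apply/(contract_ctr mS dE) => //; apply: tS'.
by rewrite !(inE, wS, negPf wE) andbF orbT.
Qed.

End Contraction.

(** * Comparison with the definitions by gluing *)

Lemma sph_embeds n (G H : space) (f : G -> H) (A : {set G}) :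
  embeds f A -> sph n (f @: A) <-> sph n A.
Proof.
elim: n A => [|n IH] A fA; have [finj fadj] := fA.
  rewrite /= card_in_imset //; split=> -[cA aA]; split=> //.
    by move=> x y xA yA; rewrite -fadj // aA ?imset_f.
  by move=> _ _ /imsetP[x xA ->] /imsetP[y yA ->]; rewrite fadj // aA.
have IHr x : x \in A -> sph n (f @: A :&: rim (f x)) <-> sph n (A :&: rim x).
  move=> xA; rewrite embeds_rim //; apply: IH.
  by apply: embedsS fA; apply: subsetIl.
have hc x : x \in A -> ctr (f @: A :\ f x) <-> ctr (A :\ x).
  move=> xA; rewrite embeds_setD1 //; apply: ctr_embeds.
  by apply: embedsS fA; apply: subsetDl.
split=> -[cA rA tA]; split.
- exact/(conn_embeds fA).
- by move=> x xA; apply/IHr => //; apply: rA; apply: imset_f.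
- by move=> x xA; apply/hc => //; apply: tA; apply: imset_f.
- exact/(conn_embeds fA).
- by move=> _ /imsetP[x xA ->]; apply/IHr => //; apply: rA.
by move=> _ /imsetP[x xA ->]; apply/hc => //; apply: tA.
Qed.

Lemma mem_imset_in (aT rT : finType) (f : aT -> rT) (A B : {set aT}) x :
  {in A &, injective f} -> B \subset A -> x \in A -> (f x \in f @: B) = (x \in B).
Proof.
move=> finj sBA xA; apply/imsetP/idP => [[y yB e]|xB]; last by exists x.
by rewrite (finj x y xA (subsetP sBA _ yB) e).
Qed.

Lemma dsk_embeds n (G H : space) (f : G -> H) (A B : {set G}) :
  embeds f A -> B \subset A -> dsk n (f @: A) (f @: B) <-> dsk n A B.
Proof.
elim: n A B => [|n IH] A B fA sBA; have [finj fadj] := fA.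
  rewrite /= card_in_imset //; split=> -[-> e]; split=> //; last by rewrite e imset0.
  by apply/eqP; rewrite -(imset_eq0 f) e.
have IHr x (C : {set G}) : x \in A -> C \subset A :&: rim x ->
    dsk n (f @: A :&: rim (f x)) (f @: C) <-> dsk n (A :&: rim x) C.
  move=> xA sC; rewrite embeds_rim //; apply: IH => //.
  by apply: embedsS fA; apply: subsetIl.
have hs x : x \in A -> sph n (f @: A :&: rim (f x)) <-> sph n (A :&: rim x).
  move=> xA; rewrite embeds_rim //; apply: sph_embeds.
  by apply: embedsS fA; apply: subsetIl.
have hB : sph n (f @: B) <-> sph n B by apply: sph_embeds; apply: embedsS fA.
have mB x : x \in A -> (f x \in f @: B) = (x \in B) by exact: mem_imset_in.
split=> -[_ [cA tA] [[x xB] [y yA yB]] [dB iA sB]]; split.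
- by [].
- by split; [apply/(conn_embeds fA) | apply/(ctr_embeds fA)].
- split; first by case/imsetP: xB => z zB _; exists z.
  by case/imsetP: yA yB => z zA ->; rewrite mB // => zB; exists z.
- split; last exact/hB.
    move=> z zB; have [C dC] := dB _ (imset_f f zB); have zA := subsetP sBA _ zB.
    have sC := dsk_sub dC; rewrite embeds_rim // in sC.
    exists [set u in A :&: rim z | f u \in C].
    apply/IHr => //; first by apply/subsetP=> u; rewrite inE => /andP[].
    suff -> : f @: [set u in A :&: rim z | f u \in C] = C by [].
    apply/setP=> v; apply/imsetP/idP => [[u]|vC].
      by rewrite inE => /andP[_ uC] ->.
    have /imsetP[u uA e] := subsetP sC _ vC.
    by exists u => //; rewrite inE uA -e.
  by move=> z zA zB; apply/hs => //; apply: iA; [apply: imset_f | rewrite mB].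
- exact: imsetS.
- by split; [apply/(conn_embeds fA) | apply/(ctr_embeds fA)].
- split; first by exists (f x); apply: imset_f.
  by exists (f y); [apply: imset_f | rewrite mB].
split; last exact/hB.
  move=> _ /imsetP[z zB ->]; have [C dC] : exists C, dsk n (A :&: rim z) C := dB z zB; have zA := subsetP sBA _ zB.
  by exists (f @: C); apply/IHr => //; apply: dsk_sub dC.
by move=> _ /imsetP[z zA ->]; rewrite mB // => zB; apply/hs => //; apply: iA.
Qed.

(** The auxiliary point required by [dsk_glue] is created as [None] in [add_point Y], and the result
    is brought back along [Some]. *)
Lemma glue_sph n (G : space) (X Y Z : {set G}) :
  dsk n.+1 X Z -> dsk n.+1 Y Z -> X :&: Y = Z ->
  (forall x y, x \in X -> y \in Y -> adj x y -> x \in Z \/ y \in Z) ->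
  sph n.+1 (X :|: Y).
Proof.
move=> dX dY eZ aXY; pose i : G -> add_point Y := Some.
have iE A : embeds i A := embeds_Some Y A.
have iinj : injective i by move=> x y [].
apply/(sph_embeds _ (iE _)); rewrite imsetU.
have memi x (A : {set G}) : (i x \in i @: A) = (x \in A) by apply: mem_imset iinj.
apply: (@dsk_glue _ (None : add_point Y) _ _ _ (i @: Z)).
- by apply/dsk_embeds => //; apply: dsk_sub dX.
- by apply/dsk_embeds => //; apply: dsk_sub dY.
- by rewrite -imsetI ?eZ //; move=> x y _ _; apply: iinj.
- move=> _ _ /imsetP[x xX ->] /imsetP[y yY ->] xy; rewrite !memi.
  exact: aXY.
- by rewrite -imsetU; apply/imsetP=> -[].
rewrite -imsetU; apply/setP=> -[x|]; rewrite !inE.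
  by rewrite -/(i x) !memi inE andb_idl //= => ->; rewrite orbT.
by rewrite andbF; apply/esym/imsetP=> -[].
Qed.

Lemma iso_setT (G : space) : iso (sub [set: G]) G.
Proof. by apply/iso_sym/(iso_image (f := id)); rewrite ?imset_id. Qed.

Lemma iso_trans (G H K : space) : iso G H -> iso H K -> iso G K.
Proof.
move=> [f bf fa] [g bg ga]; exists (g \o f); first exact: bij_comp.
by move=> x y; rewrite /= ga fa.
Qed.

Lemma iso_embeds (G H : space) : iso G H ->
  exists f : G -> H, embeds f [set: G] /\ f @: [set: G] = [set: H].
Proof.
case=> f [g fK gK] fa; exists f; split.
  by split=> // x y _ _; apply: can_inj fK x y.
by apply/setP=> y; rewrite inE; apply/imsetP; exists (g y).
Qed.

Lemma contractibleP (G : space) : contractible G <-> ctr [set: G].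
Proof.
split=> c; first exact: contractible_iso c (iso_sym (iso_setT G)).
exact: contractible_iso c (iso_setT G).
Qed.

Lemma sph_iso n (G H : space) : iso G H -> sph n [set: G] -> sph n [set: H].
Proof. by case/iso_embeds=> f [fE <-] sG; apply/sph_embeds. Qed.

Lemma sph_sub n (G : space) (A : {set G}) : sph n [set: sub A] <-> sph n A.
Proof.
have := sph_embeds n (embeds_val [set: sub A]); rewrite val_setT => h.
by split=> s; apply/h.
Qed.

Lemma val_preim (G : space) (A B : {set G}) : B \subset A ->
  val @: [set x : sub A | val x \in B] = B.
Proof.
move=> sBA; apply/setP=> y; apply/imsetP/idP => [[x]|yB].
  by rewrite inE => xB ->.
by exists (Sub y (subsetP sBA _ yB)); rewrite ?inE.
Qed.

Lemma dsk_subE n (G : space) (A : {set G}) (B : {set sub A}) :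
  dsk n [set: sub A] B <-> dsk n A (val @: B).
Proof.
have := dsk_embeds n (embeds_val [set: sub A]) (subsetT B).
by rewrite val_setT => h; split=> s; apply/h.
Qed.

Lemma dsk_sub_preim n (G : space) (A B : {set G}) : B \subset A ->
  dsk n [set: sub A] [set x | val x \in B] <-> dsk n A B.
Proof. by move=> sBA; rewrite -[in X in _ <-> X](val_preim sBA); apply: dsk_subE. Qed.

Lemma sphere0P (S : space) : sphere0 S <-> sph 0 [set: S].
Proof.
rewrite /sphere0 /= cardsT; split=> -[-> aS]; split=> // x y.
by apply: aS; rewrite inE.
Qed.

(** The contractibility clause of [sph] comes from [cycle_setD1]: a punctured cycle is a path. *)
Lemma sphere1P (S : space) : sphere1 S <-> sph 1 [set: S].
Proof.
have rimE (v : S) : sphere0 (sub (rim v)) <-> sph 0 ([set: S] :&: rim v).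
  by rewrite setTI; apply: (iff_trans (sphere0P _)); apply: sph_sub.
split=> [[cS rS]|[cS rS _]].
  have mS : mfd 0 [set: S] by split; [apply/connectedP | move=> v _; apply/rimE].
  by have [[x xS] _] := mS.1; apply: (mfd_sph mS xS); case: (cycle_setD1 mS xS).
by split; [apply/connectedP | move=> v; apply/rimE/rS; rewrite inE].
Qed.

Lemma dsk1_bd (G : space) (A B : {set G}) : dsk 1 A B ->
  B = [set x in A | #|A :&: rim x| == 1].
Proof.
case=> sBA _ _ [dB iA _]; apply/setP=> x; rewrite !inE.
have [xB|xB] := boolP (x \in B).
  by have [C [-> _]] := dB x xB; rewrite (subsetP sBA).
have [xA|//] := boolP (x \in A).
by have [-> _] := iA x xA xB.
Qed.

Lemma setT_setD1 (T : finType) (x : T) : [set: T] :\ x = [set~ x].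
Proof. by rewrite setTD. Qed.

(** Puncturing a circle gives a disk bounded by the two neighbours of the removed point; conversely,
    capping the two endpoints by a new point restores a circle. *)
Lemma disk1P (D : space) (dD : {set D}) : disk1 dD <-> dsk 1 [set: D] dD.
Proof.
have bdE B : dsk 1 [set: D] B -> B = [set x : D | #|rim x| == 1].
  by move/dsk1_bd->; apply/setP=> x; rewrite !inE setTI.
split=> [[[S [v [/sphere1P sS iD]]] ->]|dD1].
  have := sph_setD1 sS (in_setT v); rewrite setTI setT_setD1 => dv.
  have sv := dsk_sub dv; move/(dsk_sub_preim _ sv): dv => dv.
  have [f [fE fT]] := iso_embeds iD.
  have := proj2 (dsk_embeds _ fE (subsetT _)) dv; rewrite fT => dB.
  by rewrite -(bdE _ dB).
split; last exact: bdE.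
exists (add_point dD), None; split; last first.
  apply/iso_sym/(iso_image (f := Some : D -> add_point dD)) => //.
    by move=> x y [].
  apply/setP=> -[x|]; rewrite !inE; first exact: imset_f.
  by apply/imsetP=> -[].
apply/sphere1P.
have <- : None |: (Some : D -> add_point dD) @: [set: D] = [set: add_point dD].
  by apply/setP=> -[x|]; rewrite !inE // imset_f.
have iE : embeds (Some : D -> add_point dD) [set: D] by apply: embeds_Some.
apply: dsk_cap (proj2 (dsk_embeds _ iE (subsetT _)) dD1) _ _.
  by apply/imsetP=> -[].
apply/setP=> -[x|]; rewrite !inE; last by rewrite andbF; apply/esym/imsetP=> -[].
by rewrite imset_f ?inE //= mem_imset //; move=> u v [].
Qed.

(** Both disks embed in the glued space and their images meet exactly in the common boundary, so
    [glue_sph] applies. *)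
Lemma sph_of_glue n (D C : space) (f : D -> C) (dD : {set D}) (dC : {set C}) :
  dsk n.+1 [set: D] dD -> dsk n.+1 [set: C] dC -> iso_on f dD dC ->
  sph n.+1 [set: glue f dD dC].
Proof.
move=> sD sC [finj fD fadj]; have [_ [[[d0 _] _] _] _ _] := sD.
pose l : D -> glue f dD dC := inl.
(* [k] inverts [f] on the boundary; the default [d0] is never reached for points of [dC]. *)
pose k c := odflt d0 [pick a in dD | f a == c].
have kP c : c \in dC -> k c \in dD /\ f (k c) = c.
  rewrite /k -fD => /imsetP[a aD ->]; case: pickP => [b /andP[bD /eqP]|] //.
  by move/(_ a); rewrite aD eqxx.
have kf a : a \in dD -> k (f a) = a.
  move=> aD; have [|kD fk] := kP (f a); first by rewrite -fD imset_f.
  exact: finj fk.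
(* A boundary point of [C] goes to its counterpart in [D], the only copy kept by the gluing. *)
pose r (c : C) : glue f dD dC := if insub c is Some u then inr u else inl (k c).
have rN (u : {y | y \notin dC}) : r (val u) = inr u by rewrite /r valK.
have rI c : c \in dC -> r c = inl (k c) by move=> cC; rewrite /r insubN // negbK.
have rV c : (exists2 u : {y | y \notin dC}, val u = c & r c = inr u) \/
            (c \in dC /\ r c = inl (k c)).
  have [cC|cC] := boolP (c \in dC); first by right; rewrite rI.
  by left; exists (exist _ c cC) => //; rewrite -rN.
have lE : embeds l [set: D] by split=> // x y _ _ [].
have rE : embeds r [set: C].
  split=> x y _ _; have [[u <- ->]|[xC ->]] := rV x;
    have [[v <- ->]|[yC ->]] := rV y => //=.
  - by case=> ->.
  - by case=> e; rewrite -(kP x xC).2 e (kP y yC).2.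
  - by have [kD ->] := kP y yC; rewrite kD adj_sym.
  - by have [kD ->] := kP x xC; rewrite kD.
  have [kx fx] := kP x xC; have [ky fy] := kP y yC.
  by rewrite -fadj // fx fy.
have dl := proj2 (dsk_embeds _ lE (subsetT _)) sD.
have dr := proj2 (dsk_embeds _ rE (subsetT _)) sC.
have elr : r @: dC = l @: dD.
  apply/setP=> z; apply/imsetP/imsetP=> [[c cC ->]|[a aD ->]].
    by exists (k c); [have [] := kP c cC | rewrite rI].
  have fa : f a \in dC by rewrite -fD imset_f.
  by exists (f a) => //; rewrite rI // kf.
rewrite elr in dr.
have <- : l @: [set: D] :|: r @: [set: C] = [set: glue f dD dC].
  apply/setP=> -[a|u]; rewrite !inE; first by rewrite (imset_f l).
  by rewrite orbC -rN imset_f.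
apply: glue_sph dl dr _ _.
  apply/setP=> z; rewrite inE; apply/andP/idP => [[/imsetP[a _ ->] /imsetP[c _]]|zZ].
    have [[u _ ->]|[cC ->]] := rV c => // -[->].
    by rewrite imset_f //; have [] := kP c cC.
  split; first exact: subsetP (imsetS l (subsetT dD)) _ zZ.
  by rewrite -elr in zZ; exact: subsetP (imsetS r (subsetT dC)) _ zZ.
move=> _ _ /imsetP[a _ ->] /imsetP[c _ ->].
have [[u _ ->]|[cC rc]] := rV c; last by right; rewrite -elr imset_f.
by case/andP=> aD _; left; rewrite imset_f.
Qed.

(** The sphere is cut along [rim x] into the complement of a point [x] and the ball [x |: rim x]. *)
Lemma glue_of_sph n (S : space) : sph n.+1 [set: S] ->
  exists (D C : space) (dD : {set D}) (dC : {set C}) (f : D -> C),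
  [/\ dsk n.+1 [set: D] dD, dsk n.+1 [set: C] dC, iso_on f dD dC
    & iso (glue f dD dC) S].
Proof.
move=> sS; have [x _] := sph_ne sS.
have sr : sph n (rim x) by have := (sph_mfd sS).2 x (in_setT x); rewrite setTI.
pose A := [set~ x]; pose B := x |: rim x.
have dA : dsk n.+1 A (rim x).
  by have := sph_setD1 sS (in_setT x); rewrite setTI setT_setD1.
have dB : dsk n.+1 B (rim x) := dsk_ball sr (subxx _).
have sA := dsk_sub dA; have sB := dsk_sub dB.
have xB : x \in B by rewrite setU11.
(* On the common boundary [f] is the identity; elsewhere it takes the default value [x], which
   [iso_on] ignores. *)
pose f (y : sub A) : sub B := insubd (Sub x xB) (val y).
have fE (y : sub A) : val y \in rim x -> val (f y) = val y.
  by move=> yx; rewrite val_insubd (subsetP sB).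
exists (sub A), (sub B), [set y | val y \in rim x], [set y | val y \in rim x], f.
split; [exact/dsk_sub_preim | exact/dsk_sub_preim | split | ].
- move=> y z; rewrite !in_set -[adj x _]in_set -[adj x (val z)]in_set => yx zx.
  by move/(congr1 val); rewrite !fE // => /val_inj.
- apply/setP=> z; apply/imsetP/idP => [[y]|].
    by rewrite in_set => yx ->; rewrite in_set fE.
  rewrite in_set => zx; exists (Sub (val z) (subsetP sA _ zx)); first by rewrite in_set.
  by apply: val_inj; rewrite fE.
- move=> y z; rewrite [y \in _]in_set [z \in _]in_set => yx zx.
  by rewrite /= /sub_adj !fE.
apply: iso_trans (iso_setT S).
pose h (p : glue f [set y : sub A | val y \in rim x] [set y : sub B | val y \in rim x]) : S :=
  match p with inl y => val y | inr c => val (val c) end.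
have hr c : h (inr c) = x.
  case: c => -[c cB] /=; rewrite in_set /= => cx.
  by move: cB; rewrite in_setU1 (negPf cx) orbF => /eqP.
have hv (c : {z | z \notin [set z : sub B | val z \in rim x]}) : val (val c) = x.
  exact: hr c.
apply: (iso_image (f := h)).
- case=> [y|u] [z|v]; rewrite ?hr => e.
  + by congr inl; apply: val_inj.
  + by have := valP y; rewrite [val y]e !inE eqxx.
  + by have := valP z; rewrite -[val z]e !inE eqxx.
  by congr inr; do 2!apply: val_inj; exact: etrans (hr u) (esym (hr v)).
- case=> [y|u] [z|v]; rewrite ?hr //=.
  + rewrite in_set; case: (boolP (val y \in rim x)) => yx /=.
      by rewrite /sub_adj fE // hv.
    by rewrite adj_sym; move: yx; rewrite in_set => /negPf.
  + rewrite in_set; case: (boolP (val z \in rim x)) => zx /=.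
      by rewrite /sub_adj fE // hv adj_sym.
    by move: zx; rewrite in_set => /negPf.
  by rewrite /sub_adj !hv.
apply/setP=> y; rewrite in_setT; apply/imsetP.
have [->|yx] := eqVneq y x.
  have xc : (Sub x xB : sub B) \notin [set c : sub B | val c \in rim x].
    by rewrite in_set /= in_set adj_irr.
  by exists (inr (exist (fun z : sub B => z \notin _) _ xc)).
have yA : y \in A by rewrite !inE.
by exists (inl (Sub y yA)).
Qed.

(** The two are treated together since a disk refers to spheres one dimension lower and a sphere to
    disks of its own dimension. Dimensions 0 and 1 stand apart, as in the definitions. *)
Lemma sphere_disk_set n :
  (forall S : space, sphere n S <-> sph n [set: S]) /\
  (forall (D : space) (dD : {set D}), disk n dD <-> dsk n [set: D] dD).
Proof.
elim: n => [|[_|n [IHs IHd]]].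
- split; first exact: sphere0P.
  by move=> D dD; rewrite /disk /disk0 /= cardsT.
- by split; [exact: sphere1P | exact: disk1P].
have IHss (G : space) (A : {set G}) : sphere n.+1 (sub A) <-> sph n.+1 A.
  exact: iff_trans (IHs _) (sph_sub _ _).
have disks (D : space) (dD : {set D}) : disk n.+2 dD <-> dsk n.+2 [set: D] dD.
  rewrite diskSS; split.
    case=> cD tD [/set0Pn[x xD] /set0Pn[y yD]] [dB iA sB]; split.
    - exact: subsetT.
    - by split; [apply/connectedP | apply: (proj1 (contractibleP _))].
    - by split; [exists x | exists y => //; move: yD; rewrite inE].
    split; last exact/IHss.
      move=> z /dB[B dz]; exists (val @: B); rewrite setTI.
      by apply/dsk_subE/IHd.
    move=> z _ zD; rewrite setTI; apply/IHss/iA.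
    by rewrite inE.
  case=> _ [cD tD] [[x xD] [y _ yD]] [dB iA sB]; split.
  - exact/connectedP.
  - exact: (proj2 (contractibleP _)).
  - by split; apply/set0Pn; [exists x | exists y; rewrite inE].
  split; last exact/IHss.
    move=> z zD; have [C dC] : exists C, dsk n.+1 (rim z) C.
      by have := dB z zD; rewrite setTI.
    exists [set u | val u \in C].
    by apply/IHd/dsk_sub_preim => //; apply: dsk_sub dC.
  move=> z; rewrite inE => zD; apply/IHss.
  by have := iA z (in_setT z) zD; rewrite setTI.
split=> // S; rewrite sphereSS; split.
  case=> D [C [dD [dC [f [/disks sD /disks sC fP iS]]]]].
  exact: sph_iso iS (sph_of_glue sD sC fP).
move/glue_of_sph=> [D [C [dD [dC [f [sD sC fP iS]]]]]].
by exists D, C, dD, dC, f; split=> //; apply/disks.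
Qed.

Lemma sphereP n (S : space) : sphere n S <-> sph n [set: S].
Proof. by case: (sphere_disk_set n). Qed.

Lemma disk_inP n (K : space) (U dU : {set K}) : disk_in n U dU <-> dsk n U dU.
Proof.
have dP := proj2 (sphere_disk_set n); split=> [[sU /dP dU']|dU'].
  exact/dsk_sub_preim.
have sU := dsk_sub dU'; split=> //.
by apply/dP/dsk_sub_preim.
Qed.

Lemma manifoldP n (K : space) : manifold n.+1 K <-> mfd n [set: K].
Proof.
have rimE (v : K) : sphere n (sub (rim v)) <-> sph n ([set: K] :&: rim v).
  by rewrite setTI; apply: iff_trans (sphereP _ _) (sph_sub _ _).
split=> [[_ cK rK]|[cK rK]].
  by split; [apply/connectedP | move=> v _; apply/rimE].
by split=> //; [apply/connectedP | move=> v; apply/rimE/rK; rewrite inE].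
Qed.

(** * Reduction to octahedral rims *)

Lemma mfd_embeds n (G H : space) (f : G -> H) (A : {set G}) :
  embeds f A -> mfd n (f @: A) <-> mfd n A.
Proof.
move=> fA; have rE x : x \in A -> sph n (f @: A :&: rim (f x)) <-> sph n (A :&: rim x).
  move=> xA; rewrite embeds_rim //; apply: sph_embeds.
  by apply: embedsS fA; apply: subsetIl.
split=> -[cA rA]; split; try exact/(conn_embeds fA).
  by move=> x xA; apply/rE => //; apply: rA; apply: imset_f.
by move=> _ /imsetP[x xA ->]; apply/rE => //; apply: rA.
Qed.

(** Two models of one contraction are matched: [join] keeps [v] for the collapsed disk, while
    [contract_mfd] uses an added point, here [None]. The map [g] sends [v] to [None]. *)
Lemma contract_join n (N : space) (U dU : {set N}) (v : N) :
  mfd n [set: N] -> dsk n.+1 U dU -> v \in U :\: dU ->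
  let M := sub (~: ((U :\: dU) :\ v) : {set join v dU}) in
  mfd n [set: M] /\ (sph n.+1 [set: M] -> sph n.+1 [set: N]).
Proof.
move=> mN dU1 vI; set W : {set join v dU} := ~: _ => M.
pose i : N -> add_point U := Some.
have iE (A : {set N}) : embeds i A := embeds_Some U A.
have iinj : injective i by move=> x y [].
have memi x (A : {set N}) : (i x \in i @: A) = (x \in A) by apply: mem_imset iinj.
have NoneN (A : {set N}) : (None \in i @: A) = false by apply/imsetP=> -[].
pose p : add_point U := None; have pT : p \notin i @: [set: N] by rewrite NoneN.
have pU : i @: [set: N] :&: rim p = i @: U.
  by apply/setP=> -[x|]; rewrite !inE ?NoneN // -/(i x) !memi inE.
have iUT : i @: U \subset i @: [set: N] by apply/imsetS/subsetT.
have miN := proj2 (mfd_embeds n (iE [set: N])) mN.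
have diU := proj2 (dsk_embeds n.+1 (iE U) (dsk_sub dU1)) dU1.
have mS := contract_mfd miN diU iUT pT pU.
have sS := contract_sph miN diU iUT pT pU.
set S := p |: _ in mS sS.
have WP (x : N) : ((x : join v dU) \in W) = (x == v) || (x \notin U :\: dU).
  by rewrite !inE !negb_and negbK.
have SP (x : N) : (i x \in S) = (x \notin U :\: dU).
  by rewrite in_setU1 (_ : (i x == p) = false) // !in_setD !memi in_setT andbT.
pose g (x : join v dU) : add_point U := if x == v then None else Some (x : N).
have gv : g v = None by rewrite /g eqxx.
have gn (x : N) : x != v -> g x = i x by rewrite /g => /negPf->.
have vU : v \in U /\ v \notin dU by case/setDP: vI.
have rU x : x \in U -> x \notin dU -> forall y, adj x y -> y \in U.
  move=> xU xdU y xy.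
  by apply: (subsetP (dsk_int_closed mN.2 dU1 (subsetT _) xU xdU)); rewrite !inE.
(* The surviving points of [U] other than [v] form [dU], and all neighbours of the interior point
   [v] lie in [U], so adjacency to [v] in the join agrees with adjacency to [None]. *)
have jE (x : N) : x != v -> x \notin U :\: dU -> (x \in U) = adj v x || (x \in dU).
  move=> xv xI; apply/idP/orP => [xU|[vx|xd]].
  - by right; move: xI; rewrite inE xU andbT negbK.
  - by apply: rU vx; case: vU.
  by apply: (subsetP (dsk_sub dU1)).
have gE : embeds g W.
  split=> x y.
    move=> _ _; rewrite /g; case: eqVneq => [->|_]; case: eqVneq => [->|_] //.
    by case.
  rewrite !WP => xW yW; rewrite {2}/adj /= /join_adj.
  have [ex|xv] := eqVneq x v; have [ey|yv] := eqVneq y v.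
  - by rewrite ex ey gv eqxx.
  - rewrite ex gv gn //= eq_sym yv /= orbF; apply: jE => //.
    by move: yW; rewrite (negPf yv).
  - rewrite ey gv gn //= xv /= adj_sym; apply: jE => //.
    by move: xW; rewrite (negPf xv).
  rewrite !gn //= !orbF; case: eqVneq => [->|//]; exact: adj_irr.
have gW : g @: W = S.
  apply/setP=> -[x|].
    rewrite -/(i x) SP; apply/imsetP/idP => [[y yW]|xI].
      move: yW; rewrite WP; have [->|yv yI] := eqVneq y v; first by rewrite gv.
      by rewrite gn // => /iinj->.
    have xv : x != v by apply: contraNneq xI => ->.
    by exists x; rewrite ?WP ?xI ?orbT // gn.
  rewrite setU11; apply/imsetP; exists v; last by rewrite gv.
  by rewrite WP eqxx.
have subE := embeds_val [set: M].
rewrite -gW in mS sS; split.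
  by apply/(mfd_embeds _ subE); rewrite val_setT; apply/(mfd_embeds _ gE).
move=> /sph_sub sW; apply/(sph_embeds _ (iE _))/sS.
exact/(sph_embeds _ gE).
Qed.

Lemma octahedral_sph n (K : space) : mfd n.+1 [set: K] ->
  (forall D dD : {set K}, dsk n.+1 D dD ->
     forall x y, x \in D :\: dD -> y \in D :\: dD -> x = y) ->
  sph n.+2 [set: K].
Proof.
move=> mK uD; have rK (w : K) : sph n.+1 (rim w) by have := mK.2 w (in_setT w); rewrite setTI.
(* Both [x] and [y] are interior points of the disk obtained from [rim v] by deleting [u], so they
   coincide. *)
have anti (v u x y : K) : adj v u -> adj v x -> x != u -> ~~ adj u x ->
    adj v y -> y != u -> ~~ adj u y -> x = y.
  move=> vu vx xu ux vy yu uy; have uR : u \in rim v by rewrite inE.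
  apply: (uD _ _ (sph_setD1 (rK v) uR)).
    by rewrite !inE vx xu (negPf ux).
  by rewrite !inE vy yu (negPf uy).
have [v _] := mK.1.1; have [u] := sph_ne (rK v); rewrite inE => vu.
have [v' [uv' v'v vv']] : exists v', [/\ adj u v', v' != v & ~~ adj v v'].
  have [|v' [uv' v'v vv']] := sph_antipode (rK u) (x := v); first by rewrite inE adj_sym.
  by exists v'; rewrite inE in uv'.
(* Adjacency to [v'] spreads along the connected rim of [v], starting at [u]. *)
have rim_v (y : K) : adj v y -> adj v' y.
  move=> vy; have [_ cv] := (sph_mfd (rK v)).1.
  apply: (cv (fun y => adj v' y)); last by rewrite inE.
    by exists u; rewrite ?inE // adj_sym.
  move=> a b; rewrite !inE => va vb ab v'a; apply/negPn/negP => v'b.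
  have [|c [vc cb bc]] := sph_antipode (rK v) (x := b); first by rewrite inE.
  rewrite inE in vc; have ba : b != a by apply: contraTneq ab => ->; rewrite adj_irr.
  (* Otherwise [a] and [b] would both be antipodes of [c] in [rim v]. *)
  have ac : adj a c.
    apply/negPn/negP => ac; suff eab : a = b by rewrite eab eqxx in ba.
    apply: (@anti v c) => //; try by rewrite adj_sym.
      by apply: contraNneq bc => <-; rewrite adj_sym.
    by rewrite eq_sym.
  (* In [rim a] both [c] and [v'] are antipodes of [b], yet [c] is adjacent to [v] and [v'] is
     not. *)
  suff ec : c = v' by rewrite ec (negPf vv') in vc.
  apply: (@anti a b) => //; first by rewrite adj_sym.
    by apply: contraNneq vv' => ->.
  by rewrite adj_sym.
have rim_v' (y : K) : adj v' y -> adj v y.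
  move=> v'y; have [_ cv] := (sph_mfd (rK v')).1.
  apply: (cv (fun y => adj v y)); last by rewrite inE.
    by exists u; rewrite // inE adj_sym.
  move=> a b; rewrite !inE => v'a v'b ab va; apply/negPn/negP => vb.
  (* In [rim a] both [b] and [v'] are antipodes of [v]. *)
  suff eb : b = v' by rewrite eb adj_irr in v'b.
  apply: (@anti a v) => //; try by rewrite adj_sym.
  by apply: contraTneq v'b => ->; rewrite adj_sym.
(* The points [v], [v'] and the rim of [v] form a set closed under adjacency. *)
have all_K (y : K) : [|| y == v, y == v' | adj v y].
  apply: (mK.1.2 (fun y => [|| y == v, y == v' | adj v y])) => //.
    by exists v; rewrite ?eqxx.
  move=> a b _ _ ab; have [//|bv] := eqVneq b v; have [//|bv'] := eqVneq b v'.
  case/or3P=> [/eqP av|/eqP av'|va] /=; first by rewrite -av.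
    by apply: rim_v'; rewrite -av'.
  apply/negPn/negP => vb; case/eqP: bv'.
  by apply: (@anti a v) => //; rewrite adj_sym; [ | apply: rim_v].
apply: (mfd_sph mK (in_setT v)); apply: (ctr_cone (x := v')); first by rewrite !inE v'v.
apply/subsetP=> y; rewrite !inE => /and3P[yv' yv _].
by apply: rim_v; move: (all_K y); rewrite (negPf yv) (negPf yv').
Qed.

(** Forward reachability makes the hypothesis descend in the induction on the number of points: what
    is reached from a contraction of [K] is reached from [K] by prepending one step. *)
Lemma sphere3_of_small_disks (K : space) : manifold 3 K ->
  (forall K', dreachable 3 K K' -> manifold 3 K' ->
     forall D dD : {set K'}, disk_in 2 D dD ->
     exists U dU : {set K'}, disk_in 3 U dU /\ D :\: dD \subset U :\: dU) ->
  sphere 3 K.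
Proof.
have iso_refl (G : space) : iso G G by exists id => //; exists id.
have [n] := ubnP #|K|; elim: n K => // n IH K /ltnSE leKn mK hK.
have mK' := proj1 (manifoldP 2 K) mK; apply/sphereP.
(* If a 3-disk has two interior points [u] and [v], contracting it to [v] loses [u] and gives a
   smaller manifold. *)
case: (classic (exists (U dU : {set K}) (u v : K),
  [/\ dsk 3 U dU, u \in U :\: dU, v \in U :\: dU & u != v])).
  move=> [U [dU [u [v [dU1 uI vI uv]]]]].
  have [mM sM] := contract_join mK' dU1 vI; apply: sM; apply/sphereP.
  set M := sub _ in mM *.
  have mM' : manifold 3 M by apply/manifoldP.
  apply: IH => //.
    apply: leq_trans leKn; rewrite card_sig -cardsT; apply: proper_card.
    by apply/properP; split; [apply: subsetT | exists u; rewrite // !inE; move: uI; rewrite inE uv => ->].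
  move=> K' MK' mK''; apply: hK => //; apply: dreachable_step MK'.
  by apply: (dtransform_contract mK (proj2 (disk_inP 3 U dU) dU1) vI).
(* Otherwise the interior of a 2-disk, lying in that of a 3-disk, has at most one point. *)
move=> noU; apply: octahedral_sph => // D dD /disk_inP dD1 x y xI yI.
have [U [dU [/disk_inP dU1 sI]]] := hK K (dreachable_iso 3 (iso_refl K)) mK D dD dD1.
apply/eqP/negPn/negP => xy; apply: noU; exists U, dU, x, y.
by split=> //; apply: (subsetP sI).
Qed.

Theorem theorem9p1 (H : space) (hH : manifold 3 H)
  (hdisk : forall K : space, equivalent 3 H K ->
     forall D dD : {set K}, disk_in 2 D dD ->
     exists U dU : {set K}, disk_in 3 U dU /\ D :\: dD \subset U :\: dU) :
  sphere 3 H.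
Proof.
apply: (sphere3_of_small_disks hH) => K HK mK.
by apply: hdisk; split=> //; left.
Qed.
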